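(* Let $\mathcal X=\mathbb R$, $a,b>0$, $\Theta=[-a,a]\times[-b,b]\subset\mathbb R^2$, and let $f$ be the kernel $$f(x\mid\theta_1,\theta_2)=h(x)\exp\big\{\theta_1x+\theta_2e^{x^2}-A(\theta)\big\},\qquad h(x)=\exp\big(-2be^{x^2}\big),$$ where $A(\theta)=\log\int_{\mathbb R}h(x)\exp\{\theta_1x+\theta_2e^{x^2}\}\,dx$ for $\theta=(\theta_1,\theta_2)\in\Theta$. Then: (a) the only differential operator $\mathcal L_\theta=\sum_{|\alpha|\le r}c_\alpha(\theta)\partial_\theta^\alpha$ of finite order $r$, with continuous coefficients $c_\alpha$ on $\Theta^\circ$, that annihilates $f$ (i.e. $\mathcal L_\theta f(x\mid\theta)=0$ for Lebesgue-almost every $x\in\mathbb R$ and every $\theta\in\Theta^\circ$) is the trivial one (all $c_\alpha\equiv0$), so that $f$ satisfies no non-trivial parameter PDE on any non-empty open set $U\subseteq\Theta^\circ$; (b) the mixture operator $\mathcal A$ is injective on $\mathcal M(\Theta)$; that is, if $G\in\mathcal M(\Theta)$ and $\mathcal AG=0$ Lebesgue-almost everywhere on $\mathbb R$, then $G=0$.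
   Context: The dominating measure $\lambda$ on $\mathcal X=\mathbb R$ is Lebesgue measure. $\Theta^\circ$ is the interior of $\Theta$. $\mathcal M(\Theta)$ is the Banach space of finite signed Radon measures on $\Theta$. The mixture operator $\mathcal A:\mathcal M(\Theta)\to L^1(\mathbb R)$ is $(\mathcal AG)(x):=\int_\Theta f(x\mid\theta)\,G(d\theta)$. For a multi-index $\alpha=(\alpha_1,\alpha_2)\in\mathbb N_0^2$, $|\alpha|=\alpha_1+\alpha_2$ and $\partial_\theta^\alpha=\partial^{|\alpha|}/\partial\theta_1^{\alpha_1}\partial\theta_2^{\alpha_2}$ (the identity when $|\alpha|=0$). For $U\subseteq\Theta^\circ$ open and $r\in\mathbb N_0$, a parameter differential operator on $U$ of order $r$ acts on $w\in C^r(U)$ by $\mathcal L_\theta w=\sum_{|\alpha|\le r}c_\alpha(\theta)\,\partial_\theta^\alpha w$ with coefficients $c_\alpha\in C^{|\alpha|}(U)$; it is non-trivial on $U$ if $c_\alpha$ is not identically zero on $U$ for at least one $\alpha$ with $|\alpha|\ge1$. The kernel $f$ satisfies a non-trivial parameter PDE on $U$ if some parameter differential operator on $U$, non-trivial on $U$, satisfies $\mathcal L_\theta f(x\mid\theta)=0$ for $\lambda$-almost every $x$ and every $\theta\in U$. *)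

(* Defs.v *)
(* MathComp / MathComp-Analysis *)
From HB Require Import structures.
From mathcomp Require Import all_boot all_order all_algebra.
From mathcomp Require Import all_classical all_reals all_analysis.

Set Implicit Arguments.
Unset Strict Implicit.
Unset Printing Implicit Defensive.

Import Order.TTheory GRing.Theory Num.Theory.
Import numFieldNormedType.Exports.

Local Open Scope classical_set_scope.
Local Open Scope ring_scope.

Section ParameterDifferentialOperators.
Variable R : realType.
Implicit Types (w : R * R -> R) (U : set (R * R)).

Definition d1 w : R * R -> R := fun t => 'D_((1, 0) : R * R) w t.
Definition d2 w : R * R -> R := fun t => 'D_((0, 1) : R * R) w t.

Definition multi_index := (nat * nat)%type.

Definition mi_size (al : multi_index) : nat := (al.1 + al.2)%N.

Definition partial (al : multi_index) w : R * R -> R :=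
  iter al.1 d1 (iter al.2 d2 w).

(* [w] is of class C^k on the open set [U]; only the values of [w] on [U]
   matter. *)
Fixpoint Cclass (k : nat) U w : Prop :=
  {within U, continuous w} /\
  if k is k'.+1 then
    [/\ (forall t, U t -> derivable w t (1, 0)),
        (forall t, U t -> derivable w t (0, 1)),
        Cclass k' U (d1 w) & Cclass k' U (d2 w)]
  else True.

(* The family [c] of coefficients is only read at multi-indices of size at
   most [r], and, in all the predicates below, only on [U]. *)
Definition diff_op (r : nat) (c : multi_index -> R * R -> R) w (t : R * R) : R :=
  \sum_(al : 'I_r.+1 * 'I_r.+1 | (al.1 + al.2 <= r)%N)
    c (al.1 : nat, al.2 : nat) t * partial (al.1 : nat, al.2 : nat) w t.

(* The exceptional Lebesgue-null set of [x] may depend on the parameter [t]: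
   this is implied by the variant with a common null set for all [t] in [U]. *)
Definition annihilates (r : nat) (c : multi_index -> R * R -> R)
    (f : R -> R * R -> R) U : Prop :=
  forall t, U t -> {ae lebesgue_measure, forall x : R, diff_op r c (f x) t = 0}.

Definition nontrivial_on (r : nat) (c : multi_index -> R * R -> R) U : Prop :=
  exists al, (1 <= mi_size al <= r)%N /\ exists2 t, U t & c al t != 0.

Definition satisfies_nontrivial_PDE (f : R -> R * R -> R) U : Prop :=
  exists (r : nat) (c : multi_index -> R * R -> R),
    [/\ (forall al, (mi_size al <= r)%N -> Cclass (mi_size al) U (c al)),
        nontrivial_on r c U & annihilates r c f U].

End ParameterDifferentialOperators.

Section ChargeIntegral.
Context d (T : measurableType d) (R : realType).
Variable nu : {charge set T -> \bar R}.

Definition Hahn_pos : set T := sval (cid (Hahn_decomposition nu)).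

Definition Hahn_neg : set T :=
  sval (cid (svalP (cid (Hahn_decomposition nu)))).

Lemma Hahn_posneg : hahn_decomposition nu Hahn_pos Hahn_neg.
Proof. exact: svalP (cid (svalP (cid (Hahn_decomposition nu)))). Qed.

(* Integral against a finite signed measure, through its Jordan decomposition;
   by [Hahn_decomposition_uniq] the choice of Hahn sets is immaterial. *)
Definition charge_Rintegral (D : set T) (g : T -> R) : R :=
  \int[jordan_pos Hahn_posneg]_(x in D) g x -
  \int[jordan_neg Hahn_posneg]_(x in D) g x.

(* With [D] a compact subset of the plane, the elements of M(D) are the
   charges on the Borel sigma-algebra of the plane that are carried by [D];
   finite Borel signed measures on such a [D] are automatically Radon. *)
Definition carried_by (D : set T) : Prop :=
  forall E, measurable E -> nu (E `&` D) = nu E.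

End ChargeIntegral.

Section Kernel.
Variable R : realType.

Definition mixture (D : set (R * R)) (f : R -> R * R -> R)
    (G : {charge set (R * R)%type -> \bar R}) (x : R) : R :=
  charge_Rintegral G D (f x).

Definition Theta (a b : R) : set (R * R) := `[- a, a] `*` `[- b, b].

Definition hbase (b x : R) : R := expR (- 2 * b * expR (x ^+ 2)).

Definition log_partition (b : R) (t : R * R) : R :=
  ln (\int[lebesgue_measure]_x (hbase b x * expR (t.1 * x + t.2 * expR (x ^+ 2)))).

Definition expfam_kernel (b x : R) (t : R * R) : R :=
  hbase b x * expR (t.1 * x + t.2 * expR (x ^+ 2) - log_partition b t).

End Kernel.

(* Main.v *)
Require Import Defs.
From HB Require Import structures.
From mathcomp Require Import all_boot all_order all_algebra.
From mathcomp Require Import all_classical all_reals all_analysis.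
From mathcomp Require Import measurable_realfun lebesgue_integral_under.
From mathcomp Require Import ring lra.

Set Implicit Arguments.
Unset Strict Implicit.
Unset Printing Implicit Defensive.

Import Order.TTheory GRing.Theory Num.Theory.
Import numFieldNormedType.Exports.

Local Open Scope classical_set_scope.
Local Open Scope ring_scope.

(** Both halves rest on one fact, [curve_series_coef_eq0]: if the coefficients
    satisfy [`|c k m| <= M a^k b^m] and the series
      sum_(k, m) c k m x^k y^m / (k! m!),  y = exp (x^2),
    vanishes at points x > 0 accumulating at 0, then c = 0. In other words, the
    curve (x, exp (x^2)) lies in the zero set of no nonzero bivariate entire
    function of exponential type.

    The reason is analytic continuation from real to imaginary x. Split the
    series into its even and odd parts in x and write s = x^2. Each part
    becomes F(s) = sum_m e^(m s) g_m(s) / m!, where g_m is a power series in s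
    of order 1/2. Expanding in powers of s shows that F is entire
    ([expseries_entire]), so it vanishes for all real s, negative s included.
    Along s -> -oo the factors e^(m s) separate the terms: once g_0, ..., g_(m-1)
    are known to vanish, the remaining terms give g_m(s) = O(e^(s/2)). A power
    series of order 1/2 cannot decay exponentially along a half-line unless it
    is zero ([pseries_decay_eq0]): take differences of order N^2 with step N.
    They are negligible because they annihilate polynomials of lower degree, and
    they are close to the value at 0 because the other nodes lie where the
    series is tiny; hence the value at 0 is 0.

    Injectivity. Let W = e^(-A) and split the signed measure into its Jordan
    parts. The mixture at x is h(x) times the series above, with c k m the
    difference of the W-weighted moments of the two parts
    ([mixture_curve_series]); so the parts have the same weighted moments. On a
    bounded set the moments determine the integrals of exponentials, then of
    exp (- u exp (v t)), then, by bounded limits, of indicators of half-lines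
    ([same_int_halfline]) and of all Borel sets ([same_int_indic_plane]). Since
    the Jordan parts live on complementary sets and W > 0, both vanish.

    Differential operators. The normaliser and the moments of the base measure
    can be differentiated under the integral sign, so each partial derivative
    of the kernel is the kernel without its normalising factor, times a
    polynomial in x and exp (x^2) whose leading term is W x^(al_1) exp (x^2)^(al_2)
    ([partial_kernel], [coef_of_top]). An annihilating operator therefore yields
    a vanishing finite series of the kind above, all of whose coefficients are
    zero; by triangularity the c_al vanish from the top order down
    ([diff_op_kernel_eq0]). The argument takes place at one parameter at a time,
    which gives the local statement as well. *)

(** * Absolutely convergent series *)

Section AbsolutelySummableSeries.
Context {R : realType}.
Implicit Types (u v w : nat -> R) (t : nat -> nat -> R).

Definition tsum u : R := limn (series u).

Definition summableR u := cvgn (series u).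

Lemma tsumE u l : series u @ \oo --> l -> tsum u = l.
Proof. exact: cvg_lim. Qed.

Lemma eq_summable u v : u =1 v -> summableR v -> summableR u.
Proof. by move=> /funext ->. Qed.

Lemma eq_tsum u v : u =1 v -> tsum u = tsum v.
Proof. by move=> /funext ->. Qed.

Lemma summable_le u v : (forall n, `|u n| <= v n) -> summableR v -> summableR u.
Proof.
move=> uv sv; apply: normed_cvg; apply: series_le_cvg sv => //= n.
exact: le_trans (uv n).
Qed.

Lemma ler_tsum u v : (forall n, u n <= v n) -> summableR u -> summableR v ->
  tsum u <= tsum v.
Proof. by move=> uv su sv; apply: lim_series_le. Qed.

Lemma summableD u v : summableR u -> summableR v -> summableR (fun n => u n + v n).
Proof. exact: is_cvg_seriesD. Qed.

Lemma tsumD u v : summableR u -> summableR v ->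
  tsum (fun n => u n + v n) = tsum u + tsum v.
Proof. exact: lim_seriesD. Qed.

Lemma summableN u : summableR u -> summableR (fun n => - u n).
Proof. by move=> su; rewrite /summableR (_ : (fun n => _) = - u) ?is_cvg_seriesN. Qed.

Lemma tsumN u : summableR u -> tsum (fun n => - u n) = - tsum u.
Proof. exact: lim_seriesN. Qed.

Lemma summableZ (k : R) u : summableR u -> summableR (fun n => k * u n).
Proof. exact: is_cvg_seriesZ. Qed.

Lemma tsumZ (k : R) u : summableR u -> tsum (fun n => k * u n) = k * tsum u.
Proof. exact: lim_seriesZ. Qed.

Lemma tsum0 u : (forall n, u n = 0) -> tsum u = 0.
Proof.
move=> u0; apply: tsumE; rewrite (_ : series u = cst 0); first exact: cvg_cst.
by apply/funext => n; rewrite /series /= big1.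
Qed.

Lemma ler_norm_tsum u v : (forall n, `|u n| <= v n) -> summableR v ->
  `|tsum u| <= tsum v.
Proof.
move=> uv sv; have su := summable_le uv sv.
rewrite ler_norml -tsumN//; apply/andP; split; apply: ler_tsum => //.
- by move=> n; have := uv n; rewrite ler_norml => /andP[].
- exact: summableN.
- by move=> n; have := uv n; rewrite ler_norml => /andP[].
Qed.

Lemma tsum_ge0 u : summableR u -> (forall n, 0 <= u n) -> 0 <= tsum u.
Proof.
move=> su u0; rewrite -(@tsum0 (fun=> 0))//; apply: ler_tsum => //.
by apply: (summable_le _ su) => n; rewrite normr0.
Qed.

Lemma cvg_series_addn N u l : series u @ \oo --> l ->
  series (fun n => u (n + N)%N) @ \oo --> l - \sum_(n < N) u n.
Proof.
move=> ul.
rewrite (_ : series _ = (fun n => series u (n + N)%N - \sum_(n < N) u n)).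
  by apply: cvgB; [rewrite cvg_shiftn|exact: cvg_cst].
apply/funext => n; rewrite series_addn [in series u N]seriesEord/= addrC addKr.
by rewrite /series /= -{2}(add0n N) big_addn addnK.
Qed.

Lemma summable_addn N u : summableR u -> summableR (fun n => u (n + N)%N).
Proof. by move=> /cvg_ex[l /(@cvg_series_addn N)]; exact: cvgP. Qed.

Lemma summable_tail N u : summableR (fun n => u (n + N)%N) -> summableR u.
Proof.
move=> /cvg_ex[l ul]; apply: (@cvgP _ _ (l + series u N)); rewrite -(cvg_shiftn N).
rewrite [X in X @ _](_ : _ = (fun n => series (fun p => u (p + N)%N) n + series u N)).
  by apply: cvgD => //; exact: cvg_cst.
apply/funext => n /=; rewrite series_addn addrC; congr (_ + _).
by rewrite /series /= -{1}(add0n N) big_addn addnK.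
Qed.

Lemma tsum_split N u : summableR u ->
  tsum u = \sum_(n < N) u n + tsum (fun n => u (n + N)%N).
Proof.
move=> /cvg_ex[l ul].
by rewrite (tsumE ul) (tsumE (cvg_series_addn (N := N) ul)) addrC subrK.
Qed.

Lemma tsum_recl u : summableR u -> tsum u = u 0%N + tsum (fun n => u n.+1).
Proof.
move=> su; rewrite (tsum_split 1)// big_ord_recl big_ord0 addr0/=.
by congr (_ + _); apply: eq_tsum => n; rewrite addn1.
Qed.

Lemma ler_sum_tsum N u : (forall n, 0 <= u n) -> summableR u ->
  \sum_(n < N) u n <= tsum u.
Proof.
move=> u0 su; rewrite (tsum_split N su) lerDl; apply: tsum_ge0 => //.
exact: summable_addn.
Qed.

Lemma tsum_sum u : summableR u ->
  (fun N => \sum_(n < N) u n) @ \oo --> tsum u.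
Proof. by move=> su; have : series u @ \oo --> tsum u := su; rewrite seriesEord. Qed.

Lemma tsum_tail u : summableR u ->
  (fun N => tsum (fun n => u (n + N)%N)) @ \oo --> (0 : R).
Proof.
move=> su; rewrite -(subrr (tsum u)).
rewrite [X in X @ _](_ : _ = (fun N => tsum u - \sum_(n < N) u n)); last first.
  by apply/funext => N; rewrite [in RHS](tsum_split N)// addrC addKr.
by apply: cvgB; [exact: cvg_cst|exact: tsum_sum].
Qed.

Lemma summable_fin N u : (forall n, (N <= n)%N -> u n = 0) -> summableR u.
Proof.
move=> u0; apply: (@cvgP _ _ (series u N)); rewrite -(cvg_shiftn N).
rewrite (_ : (fun _ => _) = cst (series u N)); first exact: cvg_cst.
apply/funext => n; rewrite series_addn -[RHS]addr0; congr (_ + _).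
rewrite big_nat_cond big1// => i; rewrite andbT => /andP[Ni _]; exact: u0.
Qed.

Lemma tsum_fin N u : (forall n, (N <= n)%N -> u n = 0) ->
  tsum u = \sum_(n < N) u n.
Proof.
move=> u0; rewrite (tsum_split N); last exact: summable_fin u0.
by rewrite [X in _ + X]tsum0 ?addr0// => n; rewrite u0// leq_addl.
Qed.

Lemma summable_sum n (t : 'I_n -> nat -> R) : (forall i, summableR (t i)) ->
  summableR (fun j => \sum_(i < n) t i j).
Proof.
elim: n t => [|n IH] t st.
  by apply: (@summable_fin 0) => j _; rewrite big_ord0.
under eq_fun do rewrite big_ord_recr /=.
by apply: summableD => //; exact: IH.
Qed.

Lemma tsum_sum_exchange n (t : 'I_n -> nat -> R) : (forall i, summableR (t i)) ->
  tsum (fun j => \sum_(i < n) t i j) = \sum_(i < n) tsum (t i).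
Proof.
elim: n t => [|n IH] t st.
  by rewrite big_ord0 tsum0// => j; rewrite big_ord0.
under eq_fun do rewrite big_ord_recr /=.
rewrite tsumD//; last exact: summable_sum.
by rewrite big_ord_recr /=; congr (_ + _); exact: IH.
Qed.

(** Domination by a product [al i * be j] makes the two iterated sums equal:
    the error of truncating the inner sums is at most the tail of [be], scaled
    by the total mass of [al]. *)
Lemma tsum_exchange {t} (al be : nat -> R) :
  (forall i j, `|t i j| <= al i * be j) -> summableR al -> summableR be ->
  tsum (fun i => tsum (t i)) = tsum (fun j => tsum (t^~ j)).
Proof.
move=> tab sal sbe.
have tr i : summableR (t i).
  exact: summable_le (tab i) (summableZ (k := al i) sbe).
have tc j : summableR (t^~ j).
  apply: (@summable_le _ (fun i => be j * al i)); last exact: summableZ.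
  by move=> i; rewrite mulrC.
have str : summableR (fun i => tsum (t i)).
  apply: (@summable_le _ (fun i => tsum be * al i)); last exact: summableZ.
  move=> i; rewrite mulrC -tsumZ//; apply: ler_norm_tsum => //.
  exact: summableZ.
apply/esym/tsumE; rewrite seriesEord.
rewrite (_ : [sequence _]_n = (fun N =>
    tsum (fun i => tsum (t i)) - tsum (fun i => tsum (fun j => t i (j + N)%N)))).
  rewrite -[X in _ --> X]subr0; apply: cvgB; first exact: cvg_cst.
  apply/norm_cvg0P.
  apply: (@squeeze_cvgr _ _ _ _ (cst 0)
      (fun N => tsum al * tsum (fun j => be (j + N)%N))).
  - near=> N; rewrite normr_ge0/= mulrC -tsumZ//; apply: ler_norm_tsum.
      move=> i; rewrite mulrC -tsumZ; last exact: summable_addn.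
      apply: ler_norm_tsum => [j|]; first exact: tab.
      by apply: summableZ; exact: summable_addn.
    exact: summableZ.
  - exact: cvg_cst.
  - rewrite -[X in _ --> X](mulr0 (tsum al)).
    by apply: cvgM; [exact: cvg_cst|exact: tsum_tail].
apply/funext => N /=; rewrite -[LHS]/(\sum_(j < N) tsum (t^~ j)).
rewrite -(@tsum_sum_exchange N (fun j i => t i j))//.
apply/eqP; rewrite eq_sym subr_eq eq_sym -tsumD.
- by apply/eqP/eq_tsum => i; rewrite -tsum_split.
- apply: (@summable_le _ (fun i => (\sum_(j < N) be j) * al i)).
    move=> i; apply: le_trans (ler_norm_sum _ _ _) _.
    by rewrite mulrC mulr_sumr ler_sum.
  exact: summableZ.
- apply: (@summable_le _ (fun i => tsum (fun j => be (j + N)%N) * al i)).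
    move=> i; rewrite mulrC -tsumZ; last exact: summable_addn.
    by apply: ler_norm_tsum => //; apply: summableZ; exact: summable_addn.
  exact: summableZ.
Unshelve. all: by end_near. Qed.

Lemma summable_exp (x : R) : summableR (fun n => x ^+ n / n`!%:R).
Proof. exact: is_cvg_series_exp_coeff. Qed.

Lemma tsum_exp (x : R) : tsum (fun n => x ^+ n / n`!%:R) = expR x.
Proof. by []. Qed.

Lemma summable_geo (x : R) : `|x| < 1 -> summableR (fun n => x ^+ n).
Proof.
move=> x1; rewrite /summableR -[X in series X]/(GRing.exp x) exprn_geometric.
exact: is_cvg_geometric_series.
Qed.

Lemma tsum_geo (x : R) : `|x| < 1 -> tsum (fun n => x ^+ n) = (1 - x)^-1.
Proof.
move=> x1; apply: tsumE; rewrite -[X in series X]/(GRing.exp x) exprn_geometric.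
by rewrite -[X in _ --> X]mul1r; exact: cvg_geometric_series.
Qed.

Lemma ler_exp_coeff (x : R) n : 0 <= x -> x ^+ n / n`!%:R <= expR x.
Proof.
move=> x0; rewrite -tsum_exp (tsum_split n.+1); last exact: summable_exp.
have c0 k : 0 <= x ^+ k / k`!%:R by rewrite divr_ge0// exprn_ge0.
rewrite big_ord_recr/= -addrA addrCA lerDl addr_ge0// ?sumr_ge0//.
apply: tsum_ge0 => // ; apply: (@summable_addn n.+1 (fun n => x ^+ n / n`!%:R)).
exact: summable_exp.
Qed.

End AbsolutelySummableSeries.

(** * Entire functions restricted to the curve (x, exp (x^2)) *)

Section PowerSeries.
Context {R : realType}.

(** Dividing by s^j, the first nonzero coefficient would be s times a bounded
    tail. *)
Lemma pseries_eq0 (C : R) (r : nat -> R) : (forall j, `|r j| <= C) ->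
  (forall e : R, 0 < e -> exists2 s : R, 0 < s < e & tsum (fun j => r j * s ^+ j) = 0) ->
  forall j, r j = 0.
Proof.
move=> rC small; elim/ltn_ind => j IH; apply/eqP/negPn/negP => rj0.
have C0 : 0 <= C by exact: le_trans (normr_ge0 _) (rC 0%N).
have rj_gt0 : 0 < `|r j| by rewrite normr_gt0.
have e0 : 0 < Num.min 2^-1 (`|r j| / (2 * C + 1)).
  by rewrite lt_min invr_gt0 ltr0n/= divr_gt0//; lra.
have [s /andP[s0]] := small _ e0; rewrite lt_min => /andP[s1 s2] F0.
have s_lt1 : `|s| < 1 by rewrite gtr0_norm//; lra.
have sg := summable_geo s_lt1.
have bnd k n : `|r (n + k)%N * s ^+ n| <= C * s ^+ n.
  by rewrite normrM (ger0_norm (exprn_ge0 _ (ltW s0))) ler_wpM2r ?exprn_ge0// ltW.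
have sr k : summableR (fun n => r (n + k)%N * s ^+ n).
  by apply: summable_le (bnd k) _; exact: summableZ.
have := F0; rewrite (tsum_split j.+1); last first.
  by apply: (@eq_summable _ _ (fun n => r (n + 0)%N * s ^+ n)) => // n; rewrite addn0.
rewrite big_ord_recr/= big1 ?add0r; last by move=> i _; rewrite IH ?mul0r.
have -> : tsum (fun n => r (n + j.+1)%N * s ^+ (n + j.+1)) =
    s ^+ j * (s * tsum (fun n => r (n + j.+1)%N * s ^+ n)).
  rewrite mulrA -exprSr -tsumZ//; apply: eq_tsum => n.
  by rewrite exprD; ring.
rewrite (mulrC (r j)) -mulrDr => /eqP; rewrite mulf_eq0 expf_eq0 (gt_eqF s0) andbF/=.
rewrite addr_eq0 => /eqP rE; have : `|r j| <= s * (C * (1 - s)^-1).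
  rewrite rE normrN normrM (gtr0_norm s0) ler_wpM2l ?(ltW s0)//.
  by rewrite -tsum_geo// -tsumZ//; apply: ler_norm_tsum => //; exact: summableZ.
have : s * (C * (1 - s)^-1) <= s * (2 * C).
  rewrite ler_wpM2l ?(ltW s0)// mulrC ler_wpM2r//.
  by rewrite -[leRHS]invrK lef_pV2 ?posrE ?invr_gt0//; lra.
move: s2; rewrite ltr_pdivlMr; last lra.
rewrite mulrDr mulr1; lra.
Qed.

Lemma tsum_even_odd (u : nat -> R) : summableR u ->
  summableR (fun k => u k.*2) -> summableR (fun k => u k.*2.+1) ->
  tsum u = tsum (fun k => u k.*2) + tsum (fun k => u k.*2.+1).
Proof.
move=> su se so; rewrite -tsumD//; apply/esym/tsumE.
have u_dbl N : series (fun k => u k.*2 + u k.*2.+1) N = series u N.*2.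
  elim: N => [|N IH]; first by rewrite /series /= !big_geq.
  by rewrite doubleS !seriesSr IH addrA.
rewrite (_ : series _ = series u \o double); last exact/funext.
apply: (@cvg_comp _ _ _ _ _ _ \oo); last exact: su.
apply/cvgnyPge => A; near=> N; rewrite -addnn (@leq_trans N) ?leq_addr//.
by near: N; exact: nbhs_infty_ge.
Unshelve. all: by end_near.
Qed.

Lemma geo_bound (x K r s : R) j : 0 < r -> `|x| * r ^+ j <= K ->
  `|x * s ^+ j| <= K * (`|s| / r) ^+ j.
Proof.
move=> r0 xK; rewrite normrM normrX expr_div_n mulrA mulrAC ler_wpM2r ?exprn_ge0//.
by rewrite ler_pdivlMr ?exprn_gt0.
Qed.

Lemma summable_exp_type (M A s : R) (d : nat -> R) :
  (forall k, `|d k| <= M * (A ^+ k / k`!%:R)) -> summableR (fun k => d k * s ^+ k).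
Proof.
move=> dM; apply: (@summable_le _ _ (fun k => M * ((A * `|s|) ^+ k / k`!%:R))).
  by move=> k; rewrite normrM normrX exprMn mulrAC mulrA ler_wpM2r ?exprn_ge0.
by apply: summableZ; exact: summable_exp.
Qed.

Lemma norm_tsum_exp_type (M A s : R) (d : nat -> R) :
  (forall k, `|d k| <= M * (A ^+ k / k`!%:R)) ->
  `|tsum (fun k => d k * s ^+ k)| <= M * expR (A * `|s|).
Proof.
move=> dM; rewrite -tsum_exp -tsumZ; last exact: summable_exp.
apply: ler_norm_tsum => [k|]; last by apply: summableZ; exact: summable_exp.
by rewrite normrM normrX exprMn mulrAC mulrA ler_wpM2r ?exprn_ge0.
Qed.

End PowerSeries.

Section FiniteDifferences.
Context {R : realType}.

(** The n-th finite difference at 0, with unit step and up to sign. *)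
Definition fdiff n (f : nat -> R) : R :=
  \sum_(j < n.+1) (-1) ^+ j * 'C(n, j)%:R * f j.

Lemma fdiffS n f : fdiff n.+1 f = fdiff n f - fdiff n (f \o S).
Proof.
rewrite /fdiff big_ord_recl/= expr0 bin0 !mul1r.
have -> : \sum_(j < n.+1) (-1) ^+ j * 'C(n, j)%:R * f j =
    f 0%N + \sum_(j < n.+1) (-1) ^+ j.+1 * 'C(n, j.+1)%:R * f j.+1.
  rewrite [in RHS]big_ord_recr/= bin_small// mulr0 mul0r addr0.
  by rewrite big_ord_recl/= expr0 bin0 !mul1r.
rewrite -addrA; congr (_ + _); rewrite -sumrB; apply: eq_bigr => j _ /=.
by rewrite /bump /= add1n binS natrD exprS; ring.
Qed.

Lemma fdiff_sum n m (c : 'I_m -> R) (f : 'I_m -> nat -> R) :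
  fdiff n (fun j => \sum_(i < m) c i * f i j) = \sum_(i < m) c i * fdiff n (f i).
Proof.
rewrite /fdiff; under eq_bigr do rewrite mulr_sumr.
rewrite exchange_big/=; apply: eq_bigr => i _; rewrite mulr_sumr.
by apply: eq_bigr => j _; rewrite mulrCA.
Qed.

(** A unit shift changes a monomial by a polynomial of lower degree. *)
Lemma fdiff_pow_eq0 n k : (k < n)%N -> fdiff n (fun j => j%:R ^+ k) = 0.
Proof.
elim: n k => // n IH k; rewrite ltnS => kn; rewrite fdiffS.
rewrite /comp [X in _ - X](_ : _ = fdiff n (fun j => \sum_(i < k.+1) 'C(k, i)%:R * j%:R ^+ i)).
  rewrite fdiff_sum big_ord_recr/= binn mul1r big1 ?add0r ?subrr// => i _.
  by rewrite IH ?mulr0// (leq_trans _ kn).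
apply: eq_bigr => j _; rewrite -natr1 addrC exprDn; congr (_ * _).
by apply: eq_bigr => i _; rewrite expr1n mul1r mulr_natl.
Qed.

Lemma sum_binom (x : R) n : \sum_(j < n.+1) 'C(n, j)%:R * x ^+ j = (1 + x) ^+ n.
Proof. by rewrite exprDn; apply: eq_bigr => j _; rewrite expr1n mul1r mulr_natl. Qed.

Lemma norm_fdiff_pow n k : `|fdiff n (fun j => j%:R ^+ k)| <= 2 ^+ n * n%:R ^+ k.
Proof.
apply: le_trans (ler_norm_sum _ _ _) _.
rewrite (_ : 2 = 1 + 1)// -sum_binom mulr_suml ler_sum// => j _.
rewrite !normrM normrX normrN1 !expr1n mul1r mulr1 normr_nat ler_wpM2l//.
by rewrite normrX normr_nat lerXn2r ?nnegrE// ler_nat -ltnS.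
Qed.

Lemma fact_double_ge k : (k ^ k * k`! <= (k.*2)`!)%N.
Proof.
have -> : ((k.*2)`! = k.*2 ^_ k * k`!)%N.
  by rewrite -[in k`!](addnK k k) addnn ffact_fact// -addnn leq_addl.
rewrite leq_mul2r; apply/orP; right; rewrite ffact_prod -{2}[k]card_ord -prod_nat_const.
by apply: leq_prod => i _; rewrite -addnn -addnBA ?leq_addr// ltnW.
Qed.

Lemma leq_fact_sqr k : (k`! * k`! <= (k.*2)`!)%N.
Proof.
have := @bin_fact k.*2 k; rewrite -addnn leq_addr addnK => /(_ isT) <-.
by rewrite leq_pmull// bin_gt0 leq_addr.
Qed.

Lemma leq_fact_double k : (k`! <= (k.*2)`!)%N.
Proof. by rewrite leq_fact// -addnn leq_addr. Qed.

Lemma eq0_le_div_nat (x K : R) (N0 : nat) :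
  (forall N, (N0 <= N)%N -> `|x| <= K / N.+1%:R) -> x = 0.
Proof.
move=> xK; apply/eqP; rewrite -normr_le0; apply/ler_addgt0Pl => e e0; rewrite addr0.
have K0 : 0 <= K.
  by have := le_trans (normr_ge0 x) (xK N0 (leqnn _)); rewrite pmulr_lge0// invr_gt0.
pose N := maxn N0 (Num.truncn (K / e)).
apply: le_trans (xK N (leq_maxl _ _)) _.
rewrite ler_pdivrMr// mulrC -ler_pdivrMr//; apply: ltW.
apply: lt_le_trans (truncnS_gt _) _.
by rewrite ler_nat ltnS leq_maxr.
Qed.


Lemma double_fact_bound (M A : R) (d : nat -> R) : 0 <= A ->
  (forall k, `|d k| <= M * A ^+ k / (k.*2)`!%:R) ->
  forall k, `|d k| <= M * (A ^+ k / k`!%:R).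
Proof.
move=> A0 dM k; apply: le_trans (dM k) _; rewrite -mulrA.
have M0 : 0 <= M by have := le_trans (normr_ge0 _) (dM 0%N); rewrite expr0 fact0 mulr1 divr1.
rewrite ler_wpM2l// ler_wpM2l ?exprn_ge0//.
by rewrite lef_pV2 ?posrE ?ltr0n ?fact_gt0// ler_nat leq_fact_double.
Qed.

(** The n-th difference with step N of a power series only sees the terms of
    degree at least n; for n = N^2 and coefficients of size A^k/(2k)! these are
    negligible, because (n N)^k <= N^k (2k)!/k! when k >= n. *)
Lemma norm_fdiff_pseries (M A : R) (d : nat -> R) N :
  0 <= A -> (forall k, `|d k| <= M * A ^+ k / (k.*2)`!%:R) ->
  `|fdiff (N ^ 2) (fun j => tsum (fun k => d k * (j * N)%:R ^+ k))| <=
  M * expR (2 * expR 1 * A * N%:R - (N ^ 2)%:R).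
Proof.
move=> A0 dM; set n := (N ^ 2)%N.
have M0 : 0 <= M by have := le_trans (normr_ge0 _) (dM 0%N); rewrite expr0 fact0 mulr1 divr1.
have sj (j : nat) : summableR (fun k => d k * (j * N)%:R ^+ k).
  exact/summable_exp_type/(double_fact_bound A0 dM).
have -> : fdiff n (fun j => tsum (fun k => d k * (j * N)%:R ^+ k)) =
    tsum (fun k => d k * N%:R ^+ k * fdiff n (fun j => j%:R ^+ k)).
  rewrite /fdiff; under eq_bigr => j _ do rewrite -tsumZ//.
  rewrite -tsum_sum_exchange; last by move=> i; exact: summableZ.
  apply: eq_tsum => k; rewrite mulr_sumr; apply: eq_bigr => j _.
  by rewrite natrM exprMn; ring.
apply: le_trans (ler_norm_tsum (v := fun k => M * expR (- n%:R) *
   ((2 * expR 1 * A * N%:R) ^+ k / k`!%:R)) _ _) _; first last.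
- by rewrite tsumZ ?tsum_exp; [rewrite -mulrA -expRD addrC|exact: summable_exp].
- by apply: summableZ; exact: summable_exp.
move=> k; have [kn|nk] := ltnP k n.
  rewrite fdiff_pow_eq0// mulr0 normr0 mulr_ge0 ?mulr_ge0 ?expR_ge0//.
  by rewrite exprn_ge0// !mulr_ge0// expR_ge0.
have e2 : (2 ^+ n <= 2 ^+ k * expR 1 ^+ k * expR (- n%:R) :> R).
  have ek : 1 <= expR 1 ^+ k * expR (- n%:R) :> R.
    by rewrite -expRM_natl mulr1 -expRD -[leLHS](@expR0 R) ler_expR subr_ge0 ler_nat.
  rewrite -mulrA; apply: le_trans (_ : 2 ^+ k <= _).
    by rewrite ler_eXn2l// ltr1n.
  by rewrite ler_peMr ?exprn_ge0.
have nk2 : (n%:R ^+ k / (k.*2)`!%:R <= k`!%:R^-1 :> R).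
  rewrite ler_pdivrMr ?ltr0n ?fact_gt0// ler_pdivlMl ?ltr0n ?fact_gt0//.
  rewrite -natrX -natrM ler_nat mulnC; apply: leq_trans (fact_double_ge k).
  by case: (k) nk => [|k'] nk//; rewrite leq_mul2r leq_exp2r// nk orbT.
rewrite normrM normrM normrX normr_nat.
apply: le_trans (_ : M * A ^+ k / (k.*2)`!%:R * N%:R ^+ k * (2 ^+ n * n%:R ^+ k) <= _).
  by apply: ler_pM; rewrite ?mulr_ge0 ?exprn_ge0// ?norm_fdiff_pow// ler_wpM2r ?exprn_ge0.
have -> : M * A ^+ k / (k.*2)`!%:R * N%:R ^+ k * (2 ^+ n * n%:R ^+ k) =
  M * A ^+ k * N%:R ^+ k * (2 ^+ n * (n%:R ^+ k / (k.*2)`!%:R)) by ring.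
have -> : M * expR (- n%:R) * ((2 * expR 1 * A * N%:R) ^+ k / k`!%:R) =
  M * A ^+ k * N%:R ^+ k * (2 ^+ k * expR 1 ^+ k * expR (- n%:R) / k`!%:R).
  by rewrite !exprMn; ring.
rewrite ler_wpM2l ?mulr_ge0 ?exprn_ge0//.
by apply: ler_pM => //; rewrite ?exprn_ge0// divr_ge0 ?exprn_ge0.
Qed.

(** The values of g at the nodes N, 2N, ..., N^3, where g is exponentially
    small, contribute next to nothing to the N^2-th difference. The rate comes from
    N^2 exp (- N/2) <= 48 / N, the cubic term of exp, and from
    exp y - 1 <= 2 y for y <= 1/2. *)
Lemma norm_fdiff_decay (C : R) (g : R -> R) N : (96 <= N)%N ->
  (forall s, 1 <= s -> `|g s| <= C * expR (- (s / 2))) ->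
  `|fdiff (N ^ 2) (fun j => g (j * N)%:R) - g 0| <= C * (96 / N%:R).
Proof.
move=> N96 gC; set n := (N ^ 2)%N.
have N0 : 0 < N%:R :> R by rewrite ltr0n (leq_trans _ N96).
have C0 : 0 <= C.
  by have := le_trans (normr_ge0 _) (gC 1 (lexx _)); rewrite pmulr_lge0// expR_gt0.
set q := expR (- (N%:R / 2)) : R.
have q0 : 0 <= q by exact: expR_ge0.
have step1 : `|fdiff n (fun j => g (j * N)%:R) - g 0| <= C * ((1 + q) ^+ n - 1).
  rewrite /fdiff big_ord_recl/= expr0 bin0 !mul1r mul0n addrC addKr.
  rewrite -sum_binom big_ord_recl/= bin0 expr0 mulr1 [1 + _]addrC addrK mulr_sumr.
  apply: le_trans (ler_norm_sum _ _ _) _; apply: ler_sum => j _.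
  rewrite /bump/= add1n !normrM normrX normrN1 expr1n mul1r normr_nat mulrCA.
  rewrite ler_wpM2l//; apply: le_trans (gC _ _) _.
    by rewrite ler1n muln_gt0/= (leq_trans _ N96).
  rewrite ler_wpM2l// -expRM_natl ler_expR natrM; lra.
apply: le_trans step1 _; rewrite ler_wpM2l//.
have nq : n%:R * q <= 48 / N%:R.
  have : N%:R ^+ 3 / 48 <= q^-1.
    rewrite /q expRN invrK; apply: le_trans (ler_exp_coeff 3 _); last lra.
    rewrite (_ : 3`! = 6)%N// exprMn; lra.
  rewrite ler_pdivrMr// ler_pdivlMl ?expR_gt0// => h.
  rewrite ler_pdivlMr// /n natrX; apply: le_trans (_ : q * N%:R ^+ 3 <= _); last lra.
  by rewrite (exprSr _ 2); lra.
have y0 : 0 < 48 / N%:R :> R by rewrite divr_gt0.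
have y1 : 48 / N%:R <= 2^-1 :> R.
  rewrite ler_pdivrMr//; have : 96 <= N%:R :> R by rewrite ler_nat.
  lra.
have : (1 + q) ^+ n <= expR (48 / N%:R).
  apply: le_trans (_ : expR q ^+ n <= _).
    by rewrite lerXn2r ?nnegrE ?expR_ge0 ?expR_ge1Dx// addr_ge0.
  by rewrite -expRM_natl ler_expR.
have : expR (48 / N%:R) * (1 - 48 / N%:R) <= 1 :> R.
  by rewrite -[leRHS](expRxMexpNx_1 (48 / N%:R)) ler_wpM2l ?expR_ge0// expR_ge1Dx.
set E := expR _; set y := 48 / _ in y0 y1 *.
have -> : 96 / N%:R = 2 * y :> R by rewrite /y; ring.
move=> h1 h2; apply: le_trans (_ : E - 1 <= _); first lra.
have E1 : 1 <= E by rewrite -[leLHS](@expR0 R) ler_expR ltW.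
nra.
Qed.

Let pseries_decay_eq0_0 (M A C : R) (d : nat -> R) : 0 <= A ->
  (forall k, `|d k| <= M * A ^+ k / (k.*2)`!%:R) ->
  (forall s, 1 <= s -> `|tsum (fun k => d k * s ^+ k)| <= C * expR (- (s / 2))) ->
  d 0%N = 0.
Proof.
move=> A0 dM dC.
set g := fun s : R => tsum (fun k => d k * s ^+ k).
have M0 : 0 <= M by have := le_trans (normr_ge0 _) (dM 0%N); rewrite expr0 fact0 mulr1 divr1.
have C0 : 0 <= C.
  by have := le_trans (normr_ge0 _) (dC 1 (lexx _)); rewrite pmulr_lge0// expR_gt0.
have g0 : g 0 = d 0%N.
  rewrite /g (@tsum_fin _ 1) ?big_ord_recl ?big_ord0 ?addr0 ?expr0 ?mulr1//.
  by move=> [|n]// _; rewrite expr0n mulr0.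
pose N1 := (Num.truncn (2 * expR 1 * A + 1)).+1.
apply: (@eq0_le_div_nat _ (2 * M + 192 * C) (maxn 96 N1)) => N.
rewrite geq_max => /andP[N96 NA].
have N0 : 0 < N%:R :> R by rewrite ltr0n (leq_trans _ N96).
have N0' : N.+1%:R <= 2 * N%:R :> R.
  by rewrite -natr1; have : 96 <= N%:R :> R by [rewrite ler_nat]; lra.
have NA' : 2 * expR 1 * A + 1 <= N%:R.
  apply: ltW; apply: lt_le_trans (truncnS_gt _) _; by rewrite ler_nat.
have b1 := norm_fdiff_pseries N A0 dM.
have b2 := norm_fdiff_decay N96 dC.
rewrite -/(g 0) g0 in b2.
set D := fdiff _ _ in b1 b2.
have : `|d 0%N| <= M * expR (2 * expR 1 * A * N%:R - (N ^ 2)%:R) + C * (96 / N%:R).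
  rewrite -[d 0%N](subKr D); apply: le_trans (ler_normB _ _) _.
  by apply: lerD => //; rewrite distrC in b2 *.
move=> /le_trans; apply.
have : expR (2 * expR 1 * A * N%:R - (N ^ 2)%:R) <= N%:R^-1.
  apply: le_trans (_ : expR (- N%:R) <= _).
    rewrite ler_expR natrX; nra.
  rewrite expRN lef_pV2 ?posrE ?expR_gt0//.
  by apply: le_trans (expR_ge1Dx _); rewrite lerDr.
move=> /(ler_wpM2l M0) h; apply: le_trans (lerD h (lexx _)) _.
have -> : M / N%:R + C * (96 / N%:R) = (M + 96 * C) / N%:R by ring.
rewrite ler_pdivrMr// mulrAC ler_pdivlMr//; nra.
Qed.

(** The bounds (2k)! on the coefficients and e^(-s/2) on the values make the
    differences of order N^2 and step N both tend to 0 and tend to the value at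
    0. Once the constant coefficient vanishes, dividing by s preserves both
    bounds. *)
Lemma pseries_decay_eq0 (M A C : R) (d : nat -> R) : 0 <= A ->
  (forall k, `|d k| <= M * A ^+ k / (k.*2)`!%:R) ->
  (forall s, 1 <= s -> `|tsum (fun k => d k * s ^+ k)| <= C * expR (- (s / 2))) ->
  forall k, d k = 0.
Proof.
move=> A0 + + k; elim: k M C d => [|k IH] M C d dM dC.
  exact: pseries_decay_eq0_0 A0 dM dC.
have d0 := pseries_decay_eq0_0 A0 dM dC.
have M0 : 0 <= M by have := le_trans (normr_ge0 _) (dM 0%N); rewrite expr0 fact0 mulr1 divr1.
have sd s : summableR (fun k => d k * s ^+ k).
  exact/summable_exp_type/(double_fact_bound A0 dM).
apply: (IH (M * A) C (d \o S)) => [j|s s1] /=.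
  apply: le_trans (dM j.+1) _; rewrite exprS mulrA.
  rewrite ler_wpM2l// ?mulr_ge0 ?exprn_ge0//.
  rewrite lef_pV2 ?posrE ?ltr0n ?fact_gt0// ler_nat leq_fact// leq_double.
  exact: leqnSn.
have s0 : 0 < s by lra.
have -> : tsum (fun k => d k.+1 * s ^+ k) = s^-1 * tsum (fun k => d k * s ^+ k).
  rewrite (tsum_recl (sd s)) d0 mul0r add0r -tsumZ.
    by apply: eq_tsum => j; rewrite exprS mulrCA mulKf// gt_eqF.
  by have := @summable_addn _ 1 _ (sd s); under eq_fun do rewrite addn1.
rewrite normrM ger0_norm ?invr_ge0 ?(ltW s0)//; apply: le_trans (dC s s1).
by rewrite ler_piMl// invf_le1.
Qed.
End FiniteDifferences.

(** With s = x^2, the even and odd parts in x of the series studied in the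
    proof have this form. The (2k)! in the bound on the coefficients is what
    remains of x^k / k! after the substitution; it makes the inner series of
    order 1/2 in s. *)
Section ExponentialSeries.
Context {R : realType}.
Variables (M A b : R) (d : nat -> nat -> R).
Hypotheses (A0 : 0 <= A) (b0 : 0 <= b).
Hypothesis dM : forall k m, `|d k m| <= M * b ^+ m * A ^+ k / (k.*2)`!%:R.

Definition expseries (s : R) : R :=
  tsum (fun m => expR (m%:R * s) / m`!%:R * tsum (fun k => d k m * s ^+ k)).

Let M0 : 0 <= M.
Proof.
have := le_trans (normr_ge0 _) (dM 0 0); by rewrite !expr0 !fact0 !mulr1 divr1.
Qed.

Let dM1 m k : `|d k m| <= M * b ^+ m * (A ^+ k / k`!%:R).
Proof. by apply: (double_fact_bound (d := d^~ m)) => // j; exact: dM. Qed.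

(** The s^j coefficient of e^(m s) sum_k (d k m) s^k. *)
Let rho m j := \sum_(k < j.+1) d k m * (m%:R ^+ (j - k) / (j - k)`!%:R).

Let mono_exp_bound (r : R) m k j : 0 < r ->
  `|(k <= j)%:R * (m%:R ^+ (j - k) / (j - k)`!%:R)| * r ^+ j <= r ^+ k * expR (m%:R * r).
Proof.
move=> r0; have [kj|jk] := leqP k j; last first.
  by rewrite mul0r normr0 mul0r mulr_ge0 ?expR_ge0// exprn_ge0// ltW.
rewrite mul1r ger0_norm ?divr_ge0 ?exprn_ge0//.
rewrite -[in X in _ * X](subnKC kj) exprD mulrCA ler_wpM2l ?exprn_ge0 ?(ltW r0)//.
by rewrite mulrAC -exprMn; apply: ler_exp_coeff; rewrite mulr_ge0// ltW.
Qed.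

Let rho_bound (r : R) m j : 0 < r ->
  `|rho m j| * r ^+ j <= M * expR (A * r) * (b * expR r) ^+ m.
Proof.
move=> r0; have r0' := ltW r0.
have -> : M * expR (A * r) * (b * expR r) ^+ m =
    M * b ^+ m * expR (m%:R * r) * expR (A * r).
  by rewrite exprMn -expRM_natl; ring.
rewrite -[in leRHS](tsum_exp (A * r)) -tsumZ; last exact: summable_exp.
apply: le_trans (_ : \sum_(k < j.+1)
    M * b ^+ m * expR (m%:R * r) * ((A * r) ^+ k / k`!%:R) <= _).
  apply: le_trans (ler_wpM2r _ (ler_norm_sum _ _ _)) _; first by rewrite exprn_ge0.
  rewrite mulr_suml; apply: ler_sum => k _; rewrite normrM -mulrA.
  have := @mono_exp_bound r m k j r0; rewrite -ltnS ltn_ord mul1r => h.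
  apply: le_trans (ler_pM _ _ (dM1 m k) h) _ => //; first by rewrite mulr_ge0// exprn_ge0.
  by rewrite exprMn le_eqVlt; apply/orP; left; apply/eqP; ring.
rewrite [leRHS](tsum_split j.+1); last by apply: summableZ; exact: summable_exp.
rewrite lerDl; apply: tsum_ge0.
  apply: summableZ; apply: (@summable_addn _ j.+1 (fun n => (A * r) ^+ n / n`!%:R)).
  exact: summable_exp.
move=> k; rewrite !mulr_ge0 ?expR_ge0 ?exprn_ge0 ?invr_ge0//.
by rewrite mulr_ge0.
Qed.

Let expseries_term (s : R) m :
  expR (m%:R * s) * tsum (fun k => d k m * s ^+ k) = tsum (fun j => rho m j * s ^+ j).
Proof.
pose t k j := d k m * ((k <= j)%:R * (m%:R ^+ (j - k) / (j - k)`!%:R)) * s ^+ j.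
pose r := 2 * `|s| + 1.
have r0 : 0 < r by rewrite /r; have := normr_ge0 s; lra.
have sr : `|(`|s| / r)| < 1.
  by rewrite normrM normr_id normfV (gtr0_norm r0) ltr_pdivrMr// mul1r /r; have := normr_ge0 s; lra.
transitivity (tsum (fun k => tsum (t k))).
  rewrite mulrC -[RHS]/(tsum _) mulrC -tsumZ; last exact/summable_exp_type/dM1.
  apply: eq_tsum => k.
  rewrite -tsum_exp mulrC -tsumZ; last exact: summable_exp.
  have st : summableR (t k).
    apply: (@summable_le _ _ (fun j => `|d k m| * (r ^+ k * expR (m%:R * r)) * (`|s| / r) ^+ j)).
      move=> j; apply: geo_bound => //; rewrite normrM -mulrA ler_wpM2l//.
      exact: mono_exp_bound.
    by apply: summableZ; exact: summable_geo.
  rewrite (tsum_split k st) big1 ?add0r; last first.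
    by move=> i _; rewrite /t leqNgt ltn_ord/= mul0r mulr0 mul0r.
  apply: eq_tsum => j; rewrite /t leq_addl addnK mul1r exprD exprMn; ring.
rewrite (@tsum_exchange _ t (fun k => M * b ^+ m * expR (m%:R * r) * ((A * r) ^+ k / k`!%:R))
  (fun j => (`|s| / r) ^+ j)).
- apply: eq_tsum => j; rewrite (@tsum_fin _ j.+1).
    rewrite mulr_suml; apply: eq_bigr => k _; rewrite /t -ltnS ltn_ord mul1r//.
  by move=> k jk; rewrite /t leqNgt jk/= mul0r mulr0 mul0r.
- move=> k j; apply: geo_bound => //; rewrite normrM -[leLHS]mulrA.
  apply: le_trans (ler_pM _ _ (dM1 m k) (@mono_exp_bound r m k j r0)) _ => //.
    by rewrite mulr_ge0// exprn_ge0// ltW.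
  by rewrite exprMn le_eqVlt; apply/orP; left; apply/eqP; ring.
- by apply: summableZ; exact: summable_exp.
- exact: summable_geo.
Qed.

Let coef j := tsum (fun m => rho m j / m`!%:R).

Let expseriesE s : expseries s = tsum (fun j => coef j * s ^+ j).
Proof.
pose r := 2 * `|s| + 1.
have r0 : 0 < r by rewrite /r; have := normr_ge0 s; lra.
have sr : `|(`|s| / r)| < 1.
  by rewrite normrM normr_id normfV (gtr0_norm r0) ltr_pdivrMr// mul1r /r; have := normr_ge0 s; lra.
pose al m := M * expR (A * r) * ((b * expR r) ^+ m / m`!%:R).
have sal : summableR al by apply: summableZ; exact: summable_exp.
have bnd m j : `|rho m j / m`!%:R * s ^+ j| <= al m * (`|s| / r) ^+ j.
  apply: geo_bound => //; rewrite normrM normfV normr_nat mulrAC /al mulrA.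
  by rewrite ler_wpM2r// rho_bound.
transitivity (tsum (fun m => tsum (fun j => rho m j / m`!%:R * s ^+ j))).
  apply: eq_tsum => m; rewrite mulrAC expseries_term mulrC -tsumZ; last first.
    apply: (@summable_le _ _ (fun j => M * expR (A * r) * (b * expR r) ^+ m * (`|s| / r) ^+ j)).
      by move=> j; apply: geo_bound => //; exact: rho_bound.
    by apply: summableZ; exact: summable_geo.
  by apply: eq_tsum => j; ring.
rewrite (tsum_exchange bnd sal); last exact: summable_geo.
apply: eq_tsum => j; rewrite mulrC -tsumZ; first by apply: eq_tsum => m; rewrite mulrC.
apply: (@summable_le _ _ (fun m => M * expR (A * 1) * ((b * expR 1) ^+ m / m`!%:R))).
  move=> m; rewrite normrM normfV normr_nat mulrA ler_wpM2r//.
  by have := @rho_bound 1 m j ltr01; rewrite expr1n [leLHS]mulr1.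
by apply: summableZ; exact: summable_exp.
Qed.

(** Expand every e^(m s) and collect the powers of s: on a disc of radius r the
    m-th term contributes at most (b e^r)^m / m!, up to a constant, so the double
    series may be summed in either order. The power series represents the sum
    for every real s, whatever the sign. *)
Lemma expseries_entire : exists C : R, exists2 r : nat -> R, (forall j, `|r j| <= C) &
  forall s, expseries s = tsum (fun j => r j * s ^+ j).
Proof.
exists (M * expR (A * 1) * expR (b * expR 1)); exists coef; last exact: expseriesE.
move=> i; rewrite -[in leRHS](tsum_exp (b * expR 1)) -tsumZ; last exact: summable_exp.
apply: ler_norm_tsum; last by apply: summableZ; exact: summable_exp.
move=> m; rewrite normrM normfV normr_nat mulrA ler_wpM2r//.
by have := @rho_bound 1 m i ltr01; rewrite expr1n [leLHS]mulr1.
Qed.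

(** Along s -> -oo the term of index m dominates all later ones by a factor
    e^s, whereas its own coefficient, of order 1/2, cannot decay that fast. *)
Lemma expseries_coef_eq0 : (forall s, expseries s = 0) -> forall k m, d k m = 0.
Proof.
move=> F0 k m; elim/ltn_ind: m k => m IH.
pose g p s := tsum (fun k => d k p * s ^+ k).
have g_bound p s : 0 <= s -> `|g p (- s)| <= M * b ^+ p * (expR (2 * A) * expR (s / 2)).
  move=> s0; apply: le_trans (ler_norm_tsum (v := fun k =>
      M * b ^+ p * expR (2 * A) * ((s / 2) ^+ k / k`!%:R)) _ _) _.
  - move=> k; rewrite normrM normrX normrN (ger0_norm s0).
    apply: le_trans (ler_wpM2r _ (dM k p)) _; first by rewrite exprn_ge0.
    have -> : M * b ^+ p * A ^+ k / (k.*2)`!%:R * s ^+ k =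
      M * b ^+ p * ((2 * A) ^+ k * ((s / 2) ^+ k / (k.*2)`!%:R)).
      rewrite !exprMn exprVn -!mulrA; congr (_ * (_ * _)).
      rewrite [RHS](_ : _ = (2 ^+ k / 2 ^+ k) * (A ^+ k * ((k.*2)`!%:R^-1 * s ^+ k))); last by ring.
      by rewrite mulfV ?mul1r// expf_neq0// pnatr_eq0.
    rewrite -[leRHS]mulrA ler_wpM2l ?mulr_ge0 ?exprn_ge0//.
    rewrite [leRHS]mulrCA [leLHS]mulrCA ler_wpM2l ?exprn_ge0 ?divr_ge0//.
    apply: le_trans (_ : (2 * A) ^+ k / k`!%:R / k`!%:R <= _).
      rewrite -mulrA -invfM ler_wpM2l ?exprn_ge0 ?mulr_ge0//.
      by rewrite lef_pV2 ?posrE ?mulr_gt0 ?ltr0n ?fact_gt0// -natrM ler_nat leq_fact_sqr.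
    by rewrite ler_wpM2r// ler_exp_coeff// mulr_ge0.
  - by apply: summableZ; exact: summable_exp.
  - rewrite tsumZ ?tsum_exp ?mulrA//; exact: summable_exp.
pose K := M * expR (2 * A) * (b ^+ m.+1 * expR b).
suff sgn0 k : (-1) ^+ k * d k m = 0.
  by move=> k; have /eqP := sgn0 k; rewrite mulf_eq0 signr_eq0 => /eqP.
apply: (@pseries_decay_eq0 _ (M * b ^+ m) A (m`!%:R * K)
  (fun k => (-1) ^+ k * d k m) A0) => [{}k|s s1]; last first.
  have s0 : 0 <= s by lra.
  rewrite (_ : tsum _ = g m (- s)); last first.
    by apply: eq_tsum => j; rewrite (exprNn s) mulrA (mulrC (d j m)).
  pose u p := expR (p%:R * - s) / p`!%:R * g p (- s).
  have u_bound p : `|u (p + m.+1)%N| <= expR (- m.+1%:R * s) * expR (s / 2) * (M * expR (2 * A)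
     * b ^+ m.+1) * (b ^+ p / p`!%:R).
    rewrite /u !normrM ger0_norm ?expR_ge0// ger0_norm ?invr_ge0//.
    apply: le_trans (_ : expR (- m.+1%:R * s) / p`!%:R * (M * b ^+ (p + m.+1) *
      (expR (2 * A) * expR (s / 2))) <= _); last first.
      by rewrite exprD le_eqVlt; apply/orP; left; apply/eqP; ring.
    apply: ler_pM; [by rewrite divr_ge0 ?expR_ge0|by []| |exact: g_bound].
    apply: ler_pM; rewrite ?expR_ge0 ?invr_ge0//.
      rewrite ler_expR natrD mulrN mulNr lerN2 ler_wpM2r// lerDr//.
    by rewrite lef_pV2 ?posrE ?ltr0n ?fact_gt0// ler_nat leq_fact// leq_addr.
  have su' : summableR (fun p => u (p + m.+1)%N).
    by apply: summable_le u_bound _; apply: summableZ; exact: summable_exp.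
  have su : summableR u.
    exact: summable_tail su'.
  have := F0 (- s); rewrite /expseries -/(tsum u) (tsum_split m.+1)//.
  rewrite big_ord_recr/= big1 ?add0r; last first.
    move=> i _; rewrite /u /g tsum0 ?mulr0// => j.
    by rewrite IH ?mul0r.
  move=> /eqP; rewrite addr_eq0 => /eqP um.
  have {}um : u m = - tsum (fun p => u (p + m.+1)%N) by exact: um.
  have : `|u m| <= expR (- m.+1%:R * s) * expR (s / 2) * K.
    rewrite um normrN; apply: le_trans (ler_norm_tsum u_bound _) _.
      by apply: summableZ; exact: summable_exp.
    by rewrite tsumZ ?tsum_exp /K ?mulrA//; exact: summable_exp.
  rewrite /u !normrM ger0_norm ?expR_ge0// ger0_norm ?invr_ge0//.
  have fm : 0 < m`!%:R :> R by rewrite ltr0n fact_gt0.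
  rewrite -mulrA -(ler_pM2l (_ : 0 < expR (m%:R * s) * m`!%:R)) ?mulr_gt0 ?expR_gt0//.
  have -> : expR (m%:R * s) * m`!%:R * (expR (m%:R * - s) * (m`!%:R^-1 * `|g m (- s)|)) =
     (expR (m%:R * s) * expR (- (m%:R * s))) * (m`!%:R / m`!%:R) * `|g m (- s)|.
     by rewrite mulrN; ring.
  rewrite expRxMexpNx_1 mulfV ?gt_eqF// !mul1r => /le_trans; apply.
  have -> : - (s / 2) = m%:R * s + (- m.+1%:R * s) + s / 2.
    by have -> : m.+1%:R = m%:R + 1 :> R by [rewrite natr1]; field.
  by rewrite !expRD le_eqVlt; apply/orP; left; apply/eqP; ring.
rewrite normrM normrX normrN1 expr1n mul1r; exact: dM.
Qed.

End ExponentialSeries.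

(** The exponential generating series of [c] in two variables, restricted to
    the curve [(x, exp (x ^+ 2))]. *)
Definition curve_series {R : realType} (c : nat -> nat -> R) (x : R) : R :=
  tsum (fun m => expR (x ^+ 2) ^+ m / m`!%:R * tsum (fun k => x ^+ k / k`!%:R * c k m)).

Section CurveSummability.
Context {R : realType}.
Variables (M a b x : R) (c : nat -> nat -> R).
Hypothesis cM : forall k m, `|c k m| <= M * a ^+ k * b ^+ m.

Let inner_le m k :
  `|x ^+ k / k`!%:R * c k m| <= M * b ^+ m * ((a * `|x|) ^+ k / k`!%:R).
Proof.
rewrite !normrM normrX normfV normr_nat exprMn mulrC.
apply: le_trans (ler_wpM2r _ (cM k m)) _; first by rewrite divr_ge0// exprn_ge0.
by rewrite le_eqVlt; apply/orP; left; apply/eqP; ring.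
Qed.

Lemma summable_curve_inner m : summableR (fun k => x ^+ k / k`!%:R * c k m).
Proof. by apply: summable_le (inner_le m) _; apply: summableZ; exact: summable_exp. Qed.

Lemma summable_curve_outer : summableR (fun m =>
  expR (x ^+ 2) ^+ m / m`!%:R * tsum (fun k => x ^+ k / k`!%:R * c k m)).
Proof.
apply: (@summable_le _ _ (fun m => M * expR (a * `|x|) * ((b * expR (x ^+ 2)) ^+ m / m`!%:R))).
  move=> m; rewrite normrM ger0_norm ?divr_ge0 ?exprn_ge0 ?expR_ge0//.
  have -> : M * expR (a * `|x|) * ((b * expR (x ^+ 2)) ^+ m / m`!%:R) =
     expR (x ^+ 2) ^+ m / m`!%:R * (M * b ^+ m * expR (a * `|x|)) by rewrite exprMn; ring.
  rewrite ler_wpM2l ?divr_ge0 ?exprn_ge0 ?expR_ge0//.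
  rewrite -tsum_exp -tsumZ; last exact: summable_exp.
  by apply: ler_norm_tsum (inner_le m) _; apply: summableZ; exact: summable_exp.
by apply: summableZ; exact: summable_exp.
Qed.

End CurveSummability.

Lemma curve_seriesB {R : realType} (M M' a b : R) (c c' : nat -> nat -> R) x :
  (forall k m, `|c k m| <= M * a ^+ k * b ^+ m) ->
  (forall k m, `|c' k m| <= M' * a ^+ k * b ^+ m) ->
  curve_series (fun k m => c k m - c' k m) x = curve_series c x - curve_series c' x.
Proof.
move=> cM cM'; rewrite /curve_series -tsumN; last exact: summable_curve_outer cM'.
rewrite -tsumD; [|exact: summable_curve_outer cM|apply: summableN; exact: summable_curve_outer cM'].
apply: eq_tsum => m; rewrite -mulrBr; congr (_ * _).
have s' := summable_curve_inner (x := x) (m := m) cM'.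
have s := summable_curve_inner (x := x) (m := m) cM.
rewrite -tsumN// -(tsumD s (summableN s')).
by apply: eq_tsum => k; rewrite mulrBr.
Qed.

(** The series is F_0(x^2) + x F_1(x^2) with F_0 and F_1 entire. Zeros
    accumulating at 0 annihilate the interleaved power series of F_0 and F_1, so
    both functions vanish at every real s, also at the negative ones, which
    correspond to imaginary x. *)
Lemma curve_series_coef_eq0 {R : realType} (M a b : R) (c : nat -> nat -> R) :
  0 <= a -> 0 <= b -> (forall k m, `|c k m| <= M * a ^+ k * b ^+ m) ->
  (forall e : R, 0 < e -> exists2 x, 0 < x < e & curve_series c x = 0) ->
  forall k m, c k m = 0.
Proof.
move=> a0 b0 cM small.
have M0 : 0 <= M by have := le_trans (normr_ge0 _) (cM 0 0); rewrite !expr0 !mulr1.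
pose d_even k m := c k.*2 m / (k.*2)`!%:R.
pose d_odd k m := c k.*2.+1 m / (k.*2.+1)`!%:R.
have de_b k m : `|d_even k m| <= M * b ^+ m * (a ^+ 2) ^+ k / (k.*2)`!%:R.
  rewrite /d_even normrM normfV normr_nat ler_wpM2r//.
  by apply: le_trans (cM _ _) _; rewrite -exprM mul2n mulrAC.
have do_b k m : `|d_odd k m| <= (M * a) * b ^+ m * (a ^+ 2) ^+ k / (k.*2)`!%:R.
  rewrite /d_odd normrM normfV normr_nat; apply: ler_pM => //.
    apply: le_trans (cM _ _) _; rewrite exprS -exprM mul2n.
    by rewrite le_eqVlt; apply/orP; left; apply/eqP; ring.
  by rewrite lef_pV2 ?posrE ?ltr0n ?fact_gt0// ler_nat leq_fact.
have a20 : 0 <= a ^+ 2 by rewrite exprn_ge0.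
have series_split x : curve_series c x = expseries d_even (x ^+ 2) + x * expseries d_odd (x ^+ 2).
  have st m := summable_curve_inner (x := x) (m := m) cM.
  have sde m : summableR (fun k => d_even k m * (x ^+ 2) ^+ k).
    exact/(@summable_exp_type _ _ _ _ (d_even^~ m))/(double_fact_bound (d := d_even^~ m))/(de_b^~ m).
  have sdo m : summableR (fun k => d_odd k m * (x ^+ 2) ^+ k).
    exact/(@summable_exp_type _ _ _ _ (d_odd^~ m))/(double_fact_bound (d := d_odd^~ m))/(do_b^~ m).
  have tde m : tsum (fun k => x ^+ k / k`!%:R * c k m) =
      tsum (fun k => d_even k m * (x ^+ 2) ^+ k) + x * tsum (fun k => d_odd k m * (x ^+ 2) ^+ k).
    have e1 k : x ^+ k.*2 / (k.*2)`!%:R * c k.*2 m = d_even k m * (x ^+ 2) ^+ k.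
      by rewrite /d_even -exprM mul2n; ring.
    have e2 k : x ^+ k.*2.+1 / (k.*2.+1)`!%:R * c k.*2.+1 m = x * (d_odd k m * (x ^+ 2) ^+ k).
      by rewrite /d_odd -exprM mul2n exprS; ring.
    rewrite (tsum_even_odd (st m)).
    - by rewrite (eq_tsum e1) (eq_tsum e2) tsumZ.
    - exact: eq_summable e1 _.
    - by apply: eq_summable e2 _; exact: summableZ.
  have se (d : nat -> nat -> R) M' :
      (forall k m, `|d k m| <= M' * b ^+ m * (a ^+ 2) ^+ k / (k.*2)`!%:R) ->
      summableR (fun m => expR (m%:R * x ^+ 2) / m`!%:R * tsum (fun k => d k m * (x ^+ 2) ^+ k)).
    move=> dM; apply: (@summable_le _ _ (fun m => M' * expR (a ^+ 2 * x ^+ 2) *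
        ((b * expR (x ^+ 2)) ^+ m / m`!%:R))).
      move=> m; rewrite normrM ger0_norm ?divr_ge0 ?expR_ge0//.
      have := @norm_tsum_exp_type _ _ _ (x ^+ 2) _ (double_fact_bound (d := d^~ m) a20 (dM^~ m)).
      move=> /(ler_wpM2l (_ : 0 <= expR (m%:R * x ^+ 2) / m`!%:R)).
      rewrite divr_ge0 ?expR_ge0// => /(_ isT) /le_trans; apply.
      rewrite ger0_norm ?sqr_ge0// exprMn -expRM_natl.
      by rewrite le_eqVlt; apply/orP; left; apply/eqP; ring.
    by apply: summableZ; exact: summable_exp.
  rewrite /curve_series /expseries -tsumZ; last exact: se do_b.
  rewrite -tsumD; [|exact: se de_b|by apply: summableZ; exact: se do_b].
  by apply: eq_tsum => m; rewrite tde -expRM_natl; ring.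
have [Ce [re reC reE]] := expseries_entire a20 b0 de_b.
have [Co [ro roC roE]] := expseries_entire a20 b0 do_b.
pose u j := if odd j then ro j./2 else re j./2.
have u_even j : u j.*2 = re j by rewrite /u odd_double doubleK.
have u_odd j : u j.*2.+1 = ro j by rewrite /u /= odd_double /= uphalf_double.
have u0 : forall j, u j = 0.
  apply: (@pseries_eq0 _ (Num.max Ce Co)) => [j|e e0].
    by rewrite /u le_max; case: ifP => _; rewrite ?reC ?roC ?orbT.
  have m0 : 0 < Num.min e 1 by rewrite lt_min e0 ltr01.
  have [x /andP[x0]] := small _ m0; rewrite lt_min => /andP[xe x1] cx0.
  exists x; first by rewrite x0.
  rewrite -[RHS]cx0 series_split reE roE.
  have xn1 : `|x ^+ 2| < 1 by rewrite ger0_norm ?sqr_ge0// expr_lt1// ltW.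
  have spow (v : nat -> R) (C y : R) : `|y| < 1 -> (forall j, `|v j| <= C) ->
      summableR (fun j => v j * y ^+ j).
    move=> y1 vC; apply: (@summable_le _ _ (fun j => C * `|y| ^+ j)).
      by move=> j; rewrite normrM normrX ler_wpM2r ?exprn_ge0.
    by apply: summableZ; apply: summable_geo; rewrite normr_id.
  have ue j : u j.*2 * x ^+ j.*2 = re j * (x ^+ 2) ^+ j by rewrite u_even -exprM mul2n.
  have uo j : u j.*2.+1 * x ^+ j.*2.+1 = x * (ro j * (x ^+ 2) ^+ j).
    by rewrite u_odd -exprM mul2n exprS mulrCA.
  have sue := eq_summable ue (spow _ _ _ xn1 reC).
  have suo := eq_summable uo (summableZ (k := x) (spow _ _ _ xn1 roC)).
  rewrite (tsum_even_odd _ sue suo).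
    by rewrite (eq_tsum ue) (eq_tsum uo) tsumZ//; exact: spow roC.
  apply: (spow _ (Num.max Ce Co)); first by rewrite gtr0_norm.
  by move=> j; rewrite /u le_max; case: ifP => _; rewrite ?reC ?roC ?orbT.
have E k m : d_even k m = 0.
  apply: (@expseries_coef_eq0 _ M (a ^+ 2) b) => // s; rewrite reE tsum0// => j.
  by rewrite -u_even u0 mul0r.
have O k m : d_odd k m = 0.
  apply: (@expseries_coef_eq0 _ (M * a) (a ^+ 2) b) => // s; rewrite roE tsum0// => j.
  by rewrite -u_odd u0 mul0r.
move=> k m; rewrite -(odd_double_half k); case: (odd k).
  rewrite add1n; have /eqP := O k./2 m; rewrite mulf_eq0 invr_eq0 pnatr_eq0.
  by rewrite (gtn_eqF (fact_gt0 _)) orbF => /eqP.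
rewrite add0n; have /eqP := E k./2 m; rewrite mulf_eq0 invr_eq0 pnatr_eq0.
by rewrite (gtn_eqF (fact_gt0 _)) orbF => /eqP.
Qed.

(** * Functions with equal integrals against two finite measures *)

Section BoundedMeasurable.
Context d (T : measurableType d) (R : realType).
Implicit Types (f g : T -> R) (D : set T).

Definition bounded_on D f := exists C : R, forall t, D t -> `|f t| <= C.

Lemma bounded_onM D f g : bounded_on D f -> bounded_on D g ->
  bounded_on D (fun t => f t * g t).
Proof.
move=> [C fC] [K gK]; exists (C * K) => t Dt; rewrite normrM.
by apply: ler_pM => //; [exact: fC|exact: gK].
Qed.

Lemma bounded_onX D f n : bounded_on D f -> bounded_on D (fun t => f t ^+ n).
Proof.
move=> [C fC]; exists (C ^+ n) => t Dt; rewrite normrX lerXn2r ?nnegrE ?fC//.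
by rewrite (le_trans _ (fC t Dt)).
Qed.

Lemma bounded_on_indic D (E : set T) : bounded_on D (\1_E : T -> R).
Proof. by exists 1 => t _; rewrite indicE normr_nat lern1 leq_b1. Qed.

Lemma bounded_on_exp D f : bounded_on D f -> bounded_on D (fun t => expR (f t)).
Proof.
move=> [C fC]; exists (expR C) => t Dt; rewrite ger0_norm ?expR_ge0// ler_expR.
by apply: le_trans (fC t Dt); exact: ler_norm.
Qed.

Variable mu : {finite_measure set T -> \bar R}.
Variable D : set T.
Hypothesis mD : measurable D.

Lemma bounded_on_integrable f : measurable_fun D f -> bounded_on D f ->
  mu.-integrable D (EFin \o f).
Proof.
move=> mf [C fC]; apply: measurable_bounded_integrable => //.
  by rewrite ltey_eq fin_num_measure.
exists C; split; first exact: num_real.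
by move=> x Cx t Dt; apply: le_trans (fC t Dt) (ltW Cx).
Qed.

Lemma norm_Rintegral_le f C : measurable_fun D f -> (forall t, D t -> `|f t| <= C) ->
  `|\int[mu]_(t in D) f t| <= C * fine (mu D).
Proof.
move=> mf fC; have intf : mu.-integrable D (EFin \o f).
  by apply: bounded_on_integrable => //; exists C.
apply: le_trans (le_normr_Rintegral mD intf) _.
rewrite -Rintegral_cst//; apply: le_Rintegral => //.
- apply: bounded_on_integrable; last by exists C => t Dt; rewrite normr_id fC.
  exact: measurableT_comp.
- by apply: bounded_on_integrable => //; exists `|C|.
Qed.

Lemma Rintegral_bounded_cvg (f_ : nat -> T -> R) f C :
  (forall n, measurable_fun D (f_ n)) ->
  (forall n t, D t -> `|f_ n t| <= C) ->
  (forall t, D t -> f_ ^~ t @ \oo --> f t) ->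
  (fun n => \int[mu]_(t in D) f_ n t) @ \oo --> \int[mu]_(t in D) f t.
Proof.
move=> mf fC ff; have mf' : measurable_fun D f by exact: measurable_fun_cvg ff.
have [|||||intf _ cvgf] := @dominated_convergence _ _ _ mu _ mD
    (fun n => EFin \o f_ n) (EFin \o f) (cst C%:E).
- by move=> n; exact/measurable_EFinP.
- exact/measurable_EFinP.
- by apply: aeW => t Dt /=; apply: cvg_EFin; [exact: nearW|exact: ff].
- by apply: (bounded_on_integrable (f := cst C)) => //; exists `|C|.
- by apply: aeW => t n Dt /=; rewrite lee_fin fC.
rewrite /Rintegral; apply: (@fine_cvg _ _ _ _ (fun n => \int[mu]_(t in D) (f_ n t)%:E)%E).
by rewrite fineK//; exact: integrable_fin_num.
Qed.

Lemma Rintegral_sum (f_ : nat -> T -> R) n :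
  (forall k, measurable_fun D (f_ k)) -> (forall k, bounded_on D (f_ k)) ->
  \int[mu]_(t in D) (\sum_(k < n) f_ k t) = \sum_(k < n) \int[mu]_(t in D) f_ k t.
Proof.
move=> mf bf; elim: n => [|n IH].
  under eq_Rintegral do rewrite big_ord0.
  by rewrite Rintegral_cst// mul0r big_ord0.
under eq_Rintegral do rewrite big_ord_recr/=.
rewrite RintegralD//.
- by rewrite IH big_ord_recr.
- apply: bounded_on_integrable; first exact: measurable_sum.
  have /choice[C fC] := bf.
  exists (\sum_(k < n) C k) => t Dt; apply: le_trans (ler_norm_sum _ _ _) _.
  by apply: ler_sum => k _; exact: fC.
- exact: bounded_on_integrable.
Qed.

Lemma Rintegral_tsum (f_ : nat -> T -> R) (al : nat -> R) :
  (forall k, measurable_fun D (f_ k)) ->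
  (forall k t, D t -> `|f_ k t| <= al k) -> summableR al ->
  \int[mu]_(t in D) tsum (f_ ^~ t) = tsum (fun k => \int[mu]_(t in D) f_ k t).
Proof.
move=> mf fal sal; have bf k : bounded_on D (f_ k) by exists (al k) => t; exact: fal.
apply/esym/tsumE; rewrite seriesEord.
rewrite (_ : [sequence _]_n = (fun n => \int[mu]_(t in D) (\sum_(k < n) f_ k t))); last first.
  by apply/funext => n; rewrite Rintegral_sum.
apply: (@Rintegral_bounded_cvg _ _ (tsum al)).
- by move=> n; exact: measurable_sum.
- move=> n t Dt; apply: le_trans (ler_norm_sum _ _ _) _.
  apply: le_trans (_ : \sum_(k < n) al k <= _).
    by apply: ler_sum => k _; exact: fal.
  by apply: ler_sum_tsum => // k; exact: le_trans (fal k t Dt).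
- move=> t Dt; apply: tsum_sum.
  by apply: summable_le sal => k; exact: fal.
Qed.

Lemma Rintegral_exp_series (g f : T -> R) (x : R) :
  measurable_fun D g -> bounded_on D g -> measurable_fun D f -> bounded_on D f ->
  \int[mu]_(t in D) (expR (x * g t) * f t) =
  tsum (fun k => x ^+ k / k`!%:R * \int[mu]_(t in D) (g t ^+ k * f t)).
Proof.
move=> mg [K gK] mf [C fC].
have bf : bounded_on D f by exists C.
have bg : bounded_on D g by exists K.
pose h k t := x ^+ k / k`!%:R * (g t ^+ k * f t).
transitivity (\int[mu]_(t in D) tsum (h^~ t)).
  apply: eq_Rintegral => t; rewrite inE => Dt.
  rewrite mulrC -tsum_exp -tsumZ; last exact: summable_exp.
  by apply: eq_tsum => k; rewrite /h exprMn; ring.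
rewrite (@Rintegral_tsum _ (fun k => `|C| * ((`|x| * `|K|) ^+ k / k`!%:R))).
- apply: eq_tsum => k; rewrite RintegralZl//; apply: bounded_on_integrable.
    by apply: measurable_funM => //; exact: measurable_funX.
  by apply: bounded_onM => //; exact: bounded_onX.
- move=> k; apply: measurable_funM; first exact: measurable_cst.
  by apply: measurable_funM => //; exact: measurable_funX.
- move=> k t Dt; rewrite /h !normrM normfV normr_nat !normrX exprMn.
  have -> : `|C| * (`|x| ^+ k * `|K| ^+ k / k`!%:R) =
    `|x| ^+ k / k`!%:R * (`|K| ^+ k * `|C|) by ring.
  rewrite ler_wpM2l ?divr_ge0 ?exprn_ge0//.
  apply: ler_pM => //; last exact: le_trans (fC t Dt) (ler_norm _).
  by rewrite lerXn2r ?nnegrE//; exact: le_trans (gK t Dt) (ler_norm _).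
- by apply: summableZ; exact: summable_exp.
Qed.

End BoundedMeasurable.

(** Two finite measures are compared through the functions that have the same
    integral against both. *)
Section SameIntegral.
Context d (T : measurableType d) (R : realType).
Variables mu nu : {finite_measure set T -> \bar R}.
Variable D : set T.
Hypothesis mD : measurable D.
Implicit Types f g : T -> R.

Definition same_int f := \int[mu]_(t in D) f t = \int[nu]_(t in D) f t.

Lemma same_int_cvg (f_ : nat -> T -> R) f C :
  (forall n, measurable_fun D (f_ n)) ->
  (forall n t, D t -> `|f_ n t| <= C) ->
  (forall t, D t -> f_ ^~ t @ \oo --> f t) ->
  (forall n, same_int (f_ n)) -> same_int f.
Proof.
move=> mf fC ff sf.
have h1 := Rintegral_bounded_cvg (mu := mu) mD mf fC ff.
have h2 := Rintegral_bounded_cvg (mu := nu) mD mf fC ff.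
rewrite /same_int -[LHS](cvg_lim _ h1)// -[RHS](cvg_lim _ h2)//.
by congr (limn _); apply/funext => n; exact: sf.
Qed.

Lemma same_int_exp g f (x : R) :
  measurable_fun D g -> bounded_on D g -> measurable_fun D f -> bounded_on D f ->
  (forall k, same_int (fun t => g t ^+ k * f t)) ->
  same_int (fun t => expR (x * g t) * f t).
Proof.
move=> mg bg mf bf gf; rewrite /same_int !Rintegral_exp_series//.
by apply: eq_tsum => k; rewrite (gf k).
Qed.

(** Dynkin's argument: the sets E in question are stable under complements
    and disjoint unions. *)
Lemma same_int_indic_gen d' (S : measurableType d') (g : T -> S) (G : set (set S)) f :
  measurable_fun setT g -> @measurable _ S = <<s G >> -> setI_closed G ->
  measurable_fun D f -> bounded_on D f -> same_int f ->
  (forall E, G E -> same_int (fun t => \1_E (g t) * f t)) ->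
  forall E, measurable E -> same_int (fun t => \1_E (g t) * f t).
Proof.
move=> mg GE GI mf [C fC] sf sG.
have bf : bounded_on D f by exists C.
have mind E : measurable E -> measurable_fun D (fun t => \1_E (g t) * f t).
  move=> mE; apply: measurable_funM => //.
  by apply: (measurableT_comp (f := \1_E : S -> R)); [exact: measurable_indic|exact: measurable_funTS].
have bind E : bounded_on D (fun t => \1_E (g t) * f t).
  by apply: bounded_onM => //; exists 1 => t _; rewrite indicE normr_nat lern1 leq_b1.
move=> E mE; move: E mE; rewrite GE => E.
apply: (dynkin_induction (P := fun E => same_int (fun t => \1_E (g t) * f t)) GE GI) => //.
- by rewrite /same_int; under eq_Rintegral do rewrite indicT mul1r;
    under [RHS]eq_Rintegral do rewrite indicT mul1r.
- move=> {}E mE sE; rewrite /same_int.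
  have cE t : \1_(~` E) (g t) * f t = f t - \1_E (g t) * f t.
    by rewrite !indicE in_setC; case: (_ \in E) => /=; rewrite ?mul1r ?mul0r ?subrr ?subr0.
  under eq_Rintegral do rewrite cE; under [RHS]eq_Rintegral do rewrite cE.
  have If (m : {finite_measure set T -> \bar R}) : m.-integrable D (EFin \o f).
    exact: bounded_on_integrable.
  have Ii (m : {finite_measure set T -> \bar R}) :
      m.-integrable D (EFin \o (fun t => \1_E (g t) * f t)).
    by apply: bounded_on_integrable => //; exact: mind.
  rewrite (RintegralB mD (If mu) (Ii mu)) (RintegralB mD (If nu) (Ii nu)).
  by rewrite sf sE.
- move=> F mF tF sF.
  have indF t k0 k : F k0 (g t) -> \1_(F k) (g t) = (k == k0)%:R :> R.
    move=> Fk0; have [->|kk0] := eqVneq k k0; first by rewrite indicE mem_set.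
    rewrite indicE memNset// => Fk; move/eqP : kk0; apply.
    by apply: tF => //; exists (g t).
  have sumF t k0 n : F k0 (g t) -> \sum_(k < n) \1_(F k) (g t) = (k0 < n)%:R :> R.
    move=> Fk0; rewrite (eq_bigr (fun k : 'I_n => ((k : nat) == k0)%:R)); last first.
      by move=> k _; exact: indF.
    case: ltnP => k0n; first rewrite (bigD1 (Ordinal k0n))//= eqxx big1 ?addr0//.
      by move=> i ik; rewrite (_ : _ == _ = false)//; apply: negbTE.
    by rewrite big1// => i _; rewrite (_ : _ == _ = false)//; apply/negbTE;
       rewrite neq_ltn (leq_trans (ltn_ord i) k0n).
  apply: (@same_int_cvg (fun n t => \sum_(k < n) \1_(F k) (g t) * f t) _ C).
  + by move=> n; apply: measurable_sum => k; exact: mind.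
  + move=> n t Dt; rewrite -mulr_suml normrM -[leRHS]mul1r ler_pM// ?fC//.
    have [[k0 Fk0]|nF] := pselect (exists k, F k (g t)).
      by rewrite (sumF t k0)// normr_nat lern1 leq_b1.
    rewrite big1 ?normr0// => k _; rewrite indicE memNset// => Fk; apply: nF; by exists k.
  + move=> t Dt; under eq_fun do rewrite -mulr_suml; apply: cvgM; last exact: cvg_cst.
    have [[k0 Fk0]|nF] := pselect (exists k, F k (g t)).
      rewrite indicE mem_set; last by exists k0.
      apply: cvg_near_cst; exists k0.+1 => // n /= kn.
      by rewrite (sumF t k0)// kn.
    rewrite indicE memNset; last by move=> [k _ Fk]; apply: nF; exists k.
    rewrite [X in X @ _](_ : _ = cst 0); first exact: cvg_cst.
    by apply/funext => n; rewrite big1// => k _; rewrite indicE memNset// => Fk; apply: nF; exists k.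
  + move=> n; rewrite /same_int !(@Rintegral_sum _ _ _ _ _ mD (fun k t => \1_(F k) (g t) * f t))//.
      by apply: eq_bigr => k _; exact: sF.
    all: by move=> k; exact: mind.
Qed.

(** The double exponentials exp (- exp (N^2 (x - s) + N)) are power series in
    exp (N^2 x), have values in [0, 1], and tend to the indicator of x < s; the
    extra N in the exponent decides the limit at x = s itself, where it is 0. *)
Lemma same_int_halfline g f (s : R) :
  measurable_fun D g -> bounded_on D g -> measurable_fun D f -> bounded_on D f ->
  (forall k, same_int (fun t => g t ^+ k * f t)) ->
  same_int (fun t => \1_(`]-oo, s[%classic) (g t) * f t).
Proof.
move=> mg bg mf bf gf.
pose w (N : nat) x : R := expR (- expR (N%:R - (N ^ 2)%:R * s) * expR ((N ^ 2)%:R * x)).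
have wE N x : w N x = expR (- expR (N%:R + (N ^ 2)%:R * (x - s))).
  by rewrite /w mulNr -expRD; congr (expR (- expR _)); ring.
have w01 N x : 0 <= w N x <= 1.
  by rewrite wE expR_ge0/= -[leRHS](@expR0 R) ler_expR oppr_le0 expR_ge0.
have mw N : measurable_fun setT (w N).
  apply: measurableT_comp => //; apply: measurable_funM => //.
  by apply: measurableT_comp => //; apply: measurable_funM.
have [C fC] := bf.
apply: (@same_int_cvg (fun N t => w N (g t) * f t) _ C).
- move=> N; apply: measurable_funM => //; exact: measurableT_comp.
- move=> N t Dt; rewrite normrM; have /andP[w0 w1] := w01 N (g t).
  by rewrite (ger0_norm w0) -[leRHS]mul1r ler_pM// fC.
- move=> t Dt; apply: cvgM; last exact: cvg_cst.
  rewrite indicE mem_setE in_itv/=.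
  have eN : (fun N : nat => expR (- N%:R) : R) @ \oo --> (0 : R) by exact: cvgn_expR.
  have [gs|sg] := ltP (g t) s.
    apply: (@squeeze_cvgr _ _ _ _ (fun N : nat => 1 - expR (- N%:R)) (cst 1)); last 2 first.
    - by rewrite -[X in _ --> X]subr0; apply: cvgB => //; exact: cvg_cst.
    - exact: cvg_cst.
    near=> N; have /andP[_ ->] := w01 N (g t); rewrite andbT wE.
    apply: le_trans (expR_ge1Dx _); rewrite lerB// ler_expR natrX.
    have : 2 <= N%:R * (s - g t).
      rewrite -ler_pdivrMr ?subr_gt0//; near: N; exact: nbhs_infty_ger.
    have : 0 <= N%:R :> R by [].
    nra.
  apply: (@squeeze_cvgr _ _ _ _ (cst 0) (fun N : nat => expR (- N%:R))) => //; last exact: cvg_cst.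
  near=> N; have /andP[-> _] := w01 N (g t); rewrite wE/= ler_expR lerN2.
  apply: le_trans (_ : expR N%:R <= _).
    by apply: le_trans (expR_ge1Dx _); rewrite lerDr.
  by rewrite ler_expR lerDl mulr_ge0// subr_ge0.
- move=> N; apply: (@same_int_exp (fun t => expR ((N ^ 2)%:R * g t))) => //.
  + by apply: measurableT_comp => //; apply: measurable_funM => //; exact: measurable_cst.
  + by apply/bounded_on_exp/bounded_onM => //; exists `|(N ^ 2)%:R|.
  + move=> k; rewrite /same_int.
    under eq_Rintegral do rewrite -expRM_natl mulrA.
    under [RHS]eq_Rintegral do rewrite -expRM_natl mulrA.
    exact: same_int_exp.
Unshelve. all: by end_near. Qed.

Lemma same_int_indic g f (E : set R) :
  measurable_fun setT g -> bounded_on D g -> measurable_fun D f -> bounded_on D f ->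
  (forall k, same_int (fun t => g t ^+ k * f t)) ->
  measurable E -> same_int (fun t => \1_E (g t) * f t).
Proof.
move=> mg bg mf bf gf; apply: (@same_int_indic_gen _ _ g (@RGenInftyO.G R)) => //.
- exact: RGenInftyO.measurableE.
- move=> _ _ [x ->] [y ->]; exists (Num.min x y).
  by apply/seteqP; split => z /=; rewrite !in_itv/= lt_min; [move=> [-> ->]|move=> /andP[]].
- have := gf 0%N; rewrite /same_int.
  by under eq_Rintegral do rewrite expr0 mul1r; under [RHS]eq_Rintegral do rewrite expr0 mul1r.
- move=> _ [x ->]; apply: same_int_halfline => //; exact: measurable_funTS.
Qed.

End SameIntegral.

Section SameIntegralPlane.
Context (R : realType).
Variables mu nu : {finite_measure set (R * R)%type -> \bar R}.
Variable D : set (R * R).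
Hypothesis mD : measurable D.
Hypotheses (bD1 : bounded_on D (@fst R R)) (bD2 : bounded_on D (@snd R R)).

(** Indicators replace the powers of the first coordinate, next to each fixed
    power of the second, and then the powers of the second. *)
Lemma same_int_indic_plane (f : R * R -> R) (E : set (R * R)) :
  measurable_fun D f -> bounded_on D f ->
  (forall k m, same_int mu nu D (fun t => t.1 ^+ k * (t.2 ^+ m * f t))) ->
  measurable E -> same_int mu nu D (fun t => \1_E t * f t).
Proof.
move=> mf bf sf mE.
have m2 m : measurable_fun D (fun t : R * R => t.2 ^+ m).
  by apply: measurable_funX; exact: measurable_funTS.
have s1 m (A : set R) : measurable A ->
    same_int mu nu D (fun t => \1_A t.1 * (t.2 ^+ m * f t)).
  move=> mA; apply: (same_int_indic mD (g := fst)) => //.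
  - exact: measurable_funM.
  - by apply: bounded_onM => //; exact: bounded_onX.
have m1 (A : set R) : measurable A -> measurable_fun D (fun t : R * R => \1_A t.1 : R).
  move=> mA; apply: (measurableT_comp (f := \1_A : R -> R)); first exact: measurable_indic.
  exact: measurable_funTS.
have s2 (A B : set R) : measurable A -> measurable B ->
    same_int mu nu D (fun t => \1_B t.2 * (\1_A t.1 * f t)).
  move=> mA mB; apply: (same_int_indic mD (g := snd)) => //.
  - by apply: measurable_funM => //; exact: m1.
  - by apply: bounded_onM => //; exists 1 => t _; rewrite indicE normr_nat lern1 leq_b1.
  - move=> m; have := s1 m A mA.
    by under eq_fun do rewrite mulrCA.
apply: (same_int_indic_gen mD (g := id)
  (G := [set A `*` B | A in measurable & B in measurable])) mE => //.
- exact: measurable_prod_measurableType.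
- move=> _ _ [A mA [B mB <-]] [A' mA' [B' mB' <-]].
  exists (A `&` A'); first exact: measurableI.
  by exists (B `&` B'); [exact: measurableI|rewrite setXI].
- by have := sf 0 0; under eq_fun do rewrite !expr0 !mul1r.
- move=> _ [A mA [B mB <-]].
  have := s2 A B mA mB; congr same_int; apply/funext => t.
  rewrite mulrA; congr (_ * _); rewrite !indicE -natrM mulnb.
  by congr (nat_of_bool _)%:R; rewrite in_setX andbC.
Qed.

End SameIntegralPlane.

(** * The kernel and its normaliser *)

Section Kernel.
Context {R : realType}.
Variable b : R.
Implicit Types (t : R * R) (x : R).

(** The kernel without its normalising factor, which is kept apart in
    [weight]. *)
Definition tilt x t : R := hbase b x * expR (t.1 * x + t.2 * expR (x ^+ 2)).

Definition partition_fun t : R := \int[lebesgue_measure]_x tilt x t.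

Definition weight t : R := expR (- log_partition b t).

Lemma weight_gt0 t : 0 < weight t. Proof. exact: expR_gt0. Qed.

Lemma expfam_kernelE x t : expfam_kernel b x t = tilt x t * weight t.
Proof. by rewrite /expfam_kernel /tilt /weight expRD mulrA. Qed.

Lemma tilt_gt0 x t : 0 < tilt x t.
Proof. by rewrite mulr_gt0 ?expR_gt0. Qed.

Lemma tilt_exp x t : tilt x t = expR (t.1 * x - (2 * b - t.2) * expR (x ^+ 2)).
Proof. by rewrite /tilt /hbase -expRD; congr expR; ring. Qed.

(** The base measure decays doubly exponentially, so every moment of the
    tilted base measure is dominated by a Gaussian, locally uniformly in the
    parameter. *)
Lemma tilt_moment_le k m (A c : R) : 0 < c ->
  exists2 C : R, 0 <= C & forall x t, `|t.1| <= A -> c <= 2 * b - t.2 ->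
    `|x ^+ k * expR (x ^+ 2) ^+ m| * tilt x t <= C * gauss_fun x.
Proof.
move=> c0; pose n := (k + m)%N; have cn0 : c != 0 by rewrite gt_eqF.
pose K : R := n`!%:R * (4 / c) ^+ n.
have K0 : 0 <= K by rewrite mulr_ge0 ?exprn_ge0 ?divr_ge0// ltW.
exists (K * expR (A ^+ 2 / c + c^-1)).
  by rewrite mulr_ge0 ?expR_ge0.
move=> x t tA tc; set y := expR (x ^+ 2).
have y1 : 1 + x ^+ 2 <= y by exact: expR_ge1Dx.
have y2 : x ^+ 2 ^+ 2 / 2 <= y.
  by have := @ler_exp_coeff R (x ^+ 2) 2; rewrite sqr_ge0; apply.
have y0 : 0 < y by exact: expR_gt0.
have xy : `|x| <= y.
  by apply: le_trans y1; rewrite ler_norml; apply/andP; split; nra.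
(* The decay exp (- c y) is spent as follows: c / 4 on the monomial, c / 4 on
   the tilt in x, and c / 2 on the Gaussian. *)
have h1 : `|x ^+ k * y ^+ m| <= K * expR (c / 4 * y).
  apply: le_trans (_ : y ^+ n <= _).
    rewrite normrM !normrX (gtr0_norm y0) exprD ler_wpM2r ?exprn_ge0 ?(ltW y0)//.
    by rewrite lerXn2r ?nnegrE ?(ltW y0).
  have := @ler_exp_coeff R (c / 4 * y) n; rewrite mulr_ge0 ?(ltW y0) ?divr_ge0 ?(ltW c0)//.
  move=> /(_ isT) /(ler_wpM2l K0); apply: le_trans; rewrite /K.
  have -> : n`!%:R * (4 / c) ^+ n * ((c / 4 * y) ^+ n / n`!%:R) =
     (n`!%:R / n`!%:R) * ((4 / c) * (c / 4) * y) ^+ n by rewrite !exprMn; ring.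
  rewrite divff ?pnatr_eq0 -?lt0n ?fact_gt0// mul1r.
  have -> : 4 / c * (c / 4) = 1 by field.
  by rewrite mul1r.
have h2 : tilt x t <= expR (A ^+ 2 / c + c / 4 * x ^+ 2 - c * y).
  rewrite tilt_exp ler_expR; apply: lerB; last by rewrite ler_wpM2r// ltW.
  apply: le_trans (ler_norm _) _; rewrite normrM.
  apply: le_trans (_ : A * `|x| <= _); first by rewrite ler_wpM2r.
  rewrite -subr_ge0.
  have -> : A ^+ 2 / c + c / 4 * x ^+ 2 - A * `|x| = c * (A / c - `|x| / 2) ^+ 2.
    by rewrite -(real_normK (num_real x)); field.
  by rewrite mulr_ge0 ?sqr_ge0// ltW.
apply: le_trans (ler_pM _ _ h1 h2) _ => //; first exact: ltW (tilt_gt0 _ _).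
rewrite /gauss_fun -[leLHS]mulrA -[leRHS]mulrA ler_wpM2l// -!expRD ler_expR.
have h3 : c / 4 * x ^+ 2 <= c / 4 * y.
  by rewrite ler_wpM2l ?divr_ge0 ?(ltW c0)//; lra.
have h4 : x ^+ 2 - c^-1 <= c / 2 * y.
  apply: le_trans (_ : c / 2 * (x ^+ 2 ^+ 2 / 2) <= _); last first.
    by rewrite ler_wpM2l ?divr_ge0 ?(ltW c0).
  rewrite -subr_ge0.
  have -> : c / 2 * (x ^+ 2 ^+ 2 / 2) - (x ^+ 2 - c^-1) = c / 4 * (x ^+ 2 - 2 / c) ^+ 2.
    by field.
  by rewrite mulr_ge0 ?sqr_ge0// divr_ge0// ltW.
have -> : c / 4 * y + (A ^+ 2 / c + c / 4 * x ^+ 2 - c * y) =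
  A ^+ 2 / c + (c / 4 * x ^+ 2 - c / 4 * y) - c / 2 * y by field.
lra.
Qed.

Lemma measurable_expx2 : measurable_fun setT (fun x : R => expR (x ^+ 2)).
Proof. by apply: measurableT_comp => //; exact: exprn_measurable. Qed.

Lemma measurable_tilt : measurable_fun setT (fun z : (R * R) * R => tilt z.2 z.1).
Proof.
have me : measurable_fun setT (fun z : (R * R) * R => expR (z.2 ^+ 2)).
  exact: (measurableT_comp measurable_expx2 measurable_snd).
have mh : measurable_fun setT (hbase b).
  by apply: measurableT_comp => //; apply: measurable_funM => //; exact: measurable_expx2.
apply: measurable_funM; first exact: (measurableT_comp mh measurable_snd).
apply: measurableT_comp => //; apply: measurable_funD; apply: measurable_funM => //.
  exact: (measurableT_comp measurable_fst measurable_fst).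
exact: (measurableT_comp measurable_snd measurable_fst).
Qed.

Lemma measurable_tiltx t : measurable_fun setT (tilt ^~ t).
Proof. exact: (measurableT_comp measurable_tilt (measurable_pair1 t)). Qed.

Lemma tilt_moment_integrable k m t : t.2 < 2 * b ->
  (@lebesgue_measure R).-integrable setT
    (EFin \o (fun x => x ^+ k * expR (x ^+ 2) ^+ m * tilt x t)).
Proof.
move=> tb; have c0 : 0 < 2 * b - t.2 by rewrite subr_gt0.
have [C C0 dom] := tilt_moment_le k m `|t.1| c0.
have ig : (@lebesgue_measure R).-integrable setT (EFin \o (fun x : R => C * gauss_fun x)).
  rewrite /comp; under eq_fun do rewrite EFinM.
  by apply: integrableZl => //; exact: integrableT_gauss.
apply: (le_integrable _ _ _ ig) => //.
  apply/measurable_EFinP; apply: measurable_funM; last exact: measurable_tiltx.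
  by apply: measurable_funM; apply: measurable_funX => //; exact: measurable_expx2.
move=> x _ /=; rewrite lee_fin normrM (gtr0_norm (tilt_gt0 _ _)).
by apply: le_trans (dom x t _ _) (ler_norm _).
Qed.

Lemma tilt_integrable t : t.2 < 2 * b ->
  (@lebesgue_measure R).-integrable setT (EFin \o (tilt ^~ t)).
Proof.
by move=> /(tilt_moment_integrable 0 0); under eq_fun do rewrite !expr0 !mul1r.
Qed.

Lemma measurable_weight : measurable_fun setT weight.
Proof.
apply: measurableT_comp => //; apply: measurableT_comp => //.
apply: measurableT_comp; first exact: measurable_ln.
apply: (measurableT_comp (fine_measurable _)) => //.
apply: (@measurable_fun_fubini_tonelli_F _ _ _ _ _ lebesgue_measure
  (fun z : (R * R) * R => (tilt z.2 z.1)%:E)).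
  by apply/measurable_EFinP; exact: measurable_tilt.
by move=> z; rewrite lee_fin ltW// tilt_gt0.
Qed.

(** The bound is the contribution of x in [0, 1]. *)
Lemma partition_fun_ge (A c0 c1 : R) : 0 < c0 -> exists2 z : R, 0 < z &
  forall t, `|t.1| <= A -> c0 <= 2 * b - t.2 <= c1 -> z <= partition_fun t.
Proof.
move=> c00; exists (expR (- A - c1 * expR 1)); first exact: expR_gt0.
move=> t tA /andP[tc0 tc1].
have intt : (@lebesgue_measure R).-integrable setT (EFin \o (tilt ^~ t)).
  by apply: tilt_integrable; rewrite -subr_gt0 (lt_le_trans c00).
have c10 : 0 <= 2 * b - t.2 by apply: le_trans tc0; exact: ltW.
pose I : set (measurableTypeR R) := `[0, 1]%classic.
have mI : measurable I by exact: measurable_itv.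
have muI : lebesgue_measure I = 1%E.
  by rewrite /I lebesgue_measure_itv/= lte_fin ltr01 oppr0 adde0.
apply: le_trans (_ : \int[lebesgue_measure]_(x in I) tilt x t <= _).
  rewrite (_ : expR _ = \int[lebesgue_measure]_(x in I) expR (- A - c1 * expR 1)); last first.
    by rewrite Rintegral_cst// [X in fine X]muI mulr1.
  have fI : (lebesgue_measure I < +oo)%E by rewrite muI ltry.
  apply: le_Rintegral => //.
  - by apply: measurable_bounded_integrable => //; exact: bounded_cst.
  - exact: integrableS intt.
  - move=> x; rewrite /I/= in_itv/= => /andP[x0 x1]; rewrite tilt_exp ler_expR.
    apply: lerB.
      have := le_trans (ler_norm (- (t.1 * x))) (_ : _ <= A).
      rewrite normrN normrM (ger0_norm x0) lerNl; apply.
      by apply: le_trans tA; rewrite ler_piMr.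
    apply: ler_pM; [by []|exact: expR_ge0|by []|].
    by rewrite ler_expR; rewrite expr_le1.
rewrite [leLHS]Rintegral_mkcond; apply: le_Rintegral => //.
  have intI : (@lebesgue_measure R).-integrable I (EFin \o tilt^~ t) by exact: integrableS intt.
  by move: intI => /(integrable_mkcond _ mI); rewrite restrict_EFin.
by move=> x _; rewrite patchE; case: ifP => // _; exact: ltW (tilt_gt0 _ _).
Qed.

Lemma weight_partition t : 0 < partition_fun t -> weight t = (partition_fun t)^-1.
Proof. by move=> Z0; rewrite /weight expRN lnK. Qed.

End Kernel.

(** * Injectivity of the mixture operator *)

Lemma ae_near_0 {R : realType} (P : R -> Prop) (e : R) :
  {ae lebesgue_measure, forall x : R, P x} -> 0 < e -> exists2 x, 0 < x < e & P x.
Proof.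
move=> [N [mN N0 NP]] e0; apply: contrapT => nex.
suff : (lebesgue_measure (`]0%R, e[%classic : set R) <= lebesgue_measure N)%E.
  by rewrite N0 lebesgue_measure_itv/= lte_fin e0 oppr0 adde0 lee_fin leNgt e0.
apply: le_measure; rewrite ?inE//; apply: subset_trans NP => x /=.
by rewrite in_itv/= => xe Px; apply: nex; exists x.
Qed.

Section MixtureInjective.
Context {R : realType}.
Variables a b : R.
Hypotheses (a0 : 0 < a) (b0 : 0 < b).

Let D := Theta a b.
Let W := weight b.

Let mD : measurable D.
Proof. by apply: measurableX; exact: measurable_itv. Qed.

Let D1 t : D t -> `|t.1| <= a.
Proof. by move=> [/=]; rewrite !in_itv/= ler_norml. Qed.

Let D2 t : D t -> `|t.2| <= b.
Proof. by move=> [/=]; rewrite !in_itv/= ler_norml => _. Qed.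

Let bD1 : bounded_on D (@fst R R). Proof. by exists a. Qed.
Let bD2 : bounded_on D (@snd R R). Proof. by exists b. Qed.

Let mW : measurable_fun D W.
Proof. by apply: measurable_funTS; exact: measurable_weight. Qed.

Let bW : bounded_on D W.
Proof.
have [z z0 zZ] := @partition_fun_ge R b a b (3 * b) b0.
exists z^-1 => t Dt; rewrite gtr0_norm ?weight_gt0//.
have Zt : z <= partition_fun b t.
  apply: zZ; first exact: D1.
  by have := D2 Dt; rewrite ler_norml => /andP[? ?]; apply/andP; split; lra.
by rewrite /W weight_partition ?(lt_le_trans z0)// lef_pV2 ?posrE ?(lt_le_trans z0).
Qed.

Let m1 k : measurable_fun D (fun t : R * R => t.1 ^+ k).
Proof. by apply: measurable_funX; exact: measurable_funTS. Qed.

Let m2 k : measurable_fun D (fun t : R * R => t.2 ^+ k).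
Proof. by apply: measurable_funX; exact: measurable_funTS. Qed.

Let me1 x : measurable_fun D (fun t : R * R => expR (x * t.1)).
Proof.
apply: measurableT_comp => //; apply: measurable_funM => //; exact: measurable_funTS.
Qed.

Let be1 x : bounded_on D (fun t : R * R => expR (x * t.1)).
Proof. by apply/bounded_on_exp/bounded_onM => //; exists `|x|. Qed.

Section Moments.
Variable mu : {finite_measure set (R * R)%type -> \bar R}.

Definition weighted_moment k m : R := \int[mu]_(t in D) (t.1 ^+ k * (t.2 ^+ m * W t)).

(** The two exponential factors of the kernel are expanded one after the
    other, the factor in exp (x^2) first. *)
Lemma mixture_curve_series x :
  \int[mu]_(t in D) expfam_kernel b x t = hbase b x * curve_series weighted_moment x.
Proof.
pose y := expR (x ^+ 2).
transitivity (\int[mu]_(t in D) (hbase b x * (expR (y * t.2) * (expR (x * t.1) * W t)))).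
  apply: eq_Rintegral => t _; rewrite expfam_kernelE /tilt -mulrA; congr (_ * _).
  by rewrite addrC expRD -mulrA -/y (mulrC t.2) (mulrC t.1).
rewrite RintegralZl//; last first.
  apply: bounded_on_integrable => //.
    apply: measurable_funM; last exact: measurable_funM.
    by apply: measurableT_comp => //; apply: measurable_funM => //; exact: measurable_funTS.
  apply: bounded_onM; last exact: bounded_onM.
  by apply/bounded_on_exp/bounded_onM => //; exists `|y|.
congr (_ * _); rewrite Rintegral_exp_series//; first last.
- exact: bounded_onM.
- exact: measurable_funM.
- exact: measurable_funTS.
apply: eq_tsum => m; congr (_ * _).
under eq_Rintegral do rewrite mulrCA.
rewrite Rintegral_exp_series//.
- exact: measurable_funTS.
- exact: measurable_funM.
- by apply: bounded_onM => //; exact: bounded_onX.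
Qed.

Lemma weighted_moment_le : exists M, forall k m, `|weighted_moment k m| <= M * a ^+ k * b ^+ m.
Proof.
have [w wW] := bW; exists (`|w| * fine (mu D)) => k m.
apply: le_trans (norm_Rintegral_le mu (C := a ^+ k * (b ^+ m * `|w|)) mD _ _) _.
- by apply: measurable_funM => //; exact: measurable_funM.
- move=> t Dt; rewrite !normrM !normrX.
  apply: ler_pM; rewrite ?mulr_ge0 ?exprn_ge0//.
    by rewrite lerXn2r ?nnegrE ?D1// ltW.
  apply: ler_pM; rewrite ?exprn_ge0//.
    by rewrite lerXn2r ?nnegrE ?D2// ltW.
  by apply: le_trans (wW t Dt) _; exact: ler_norm.
- by rewrite le_eqVlt; apply/orP; left; apply/eqP; ring.
Qed.

Lemma null_of_weight (E : set (R * R)) : measurable E ->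
  \int[mu]_(t in D) (\1_E t * W t) = 0 -> mu (D `&` E) = 0%E.
Proof.
move=> mE int0.
have mf : measurable_fun D (fun t => \1_E t * W t).
  by apply: measurable_funM => //; exact: measurable_indic.
have bf : bounded_on D (fun t => \1_E t * W t).
  by apply: bounded_onM => //; exact: bounded_on_indic.
have intf := bounded_on_integrable mu mD mf bf.
have /(ae_eq_integral_abs mu mD) : measurable_fun D (EFin \o (fun t => \1_E t * W t)).
  exact/measurable_EFinP.
move=> [+ _] => /(_ _) h.
have {}h : ae_eq mu D (EFin \o (fun t => \1_E t * W t)) (cst 0%E).
  apply: h; rewrite -[RHS]/(0%:E) -int0 /Rintegral fineK; last exact: integrable_fin_num.
  by apply: eq_integral => t _ /=; rewrite ger0_norm// mulr_ge0 ?(ltW (weight_gt0 _ _))//.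
have [N [mN N0 NP]] := h.
apply/eqP; rewrite -measure_le0 -N0; apply: le_measure; rewrite ?inE//.
  exact: measurableI.
move=> t [Dt Et]; apply: NP => /= /(_ Dt) [] /eqP.
by rewrite indicE mem_set// mul1r gt_eqF// weight_gt0.
Qed.

End Moments.

Variable G : {charge set (R * R)%type -> \bar R}.
Hypothesis GD : carried_by G D.
Hypothesis mixG0 : {ae lebesgue_measure,
  forall x : R, mixture D (@expfam_kernel R b) G x = 0}.

Let p : {finite_measure set (R * R)%type -> \bar R} := jordan_pos (Hahn_posneg G).
Let n : {finite_measure set (R * R)%type -> \bar R} := jordan_neg (Hahn_posneg G).

Let same_moments k m : same_int p n D (fun t => t.1 ^+ k * (t.2 ^+ m * W t)).
Proof.
have [M pM] := weighted_moment_le p; have [M' nM] := weighted_moment_le n.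
apply/eqP; rewrite -subr_eq0; apply/eqP.
apply: (@curve_series_coef_eq0 _ (M + M') a b (fun k m => weighted_moment p k m - weighted_moment n k m)).
- exact: ltW.
- exact: ltW.
- move=> i j; apply: le_trans (ler_normB _ _) _; rewrite !mulrDl.
  by apply: lerD; [exact: pM|exact: nM].
- move=> e e0; have [x xe] := ae_near_0 mixG0 e0.
  rewrite /mixture /charge_Rintegral => mix0; exists x => //.
  rewrite (curve_seriesB x pM nM).
  have := mixture_curve_series p x; have := mixture_curve_series n x.
  move=> hn hp; have : hbase b x * curve_series (weighted_moment p) x -
      hbase b x * curve_series (weighted_moment n) x = 0 by rewrite -hp -hn; exact: mix0.
  rewrite -mulrBr => /eqP; rewrite mulf_eq0 gt_eqF ?expR_gt0//.
  by move=> /eqP.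
Qed.

Let same_ind E : measurable E -> same_int p n D (fun t => \1_E t * W t).
Proof.
move=> mE; exact: (same_int_indic_plane mD bD1 bD2 mW bW same_moments mE).
Qed.

(** On the positive set of a Hahn decomposition the negative part has no mass,
    so its weighted integral vanishes there; that of the positive part is the
    same, and the weight is positive. The two sets play symmetric roles. *)
Lemma mixture_injective (E : set (R * R)) : measurable E -> G E = 0%E.
Proof.
move=> mE.
have [[mP posP] [mN negN] PN PN0] := Hahn_posneg G.
set P := Hahn_pos G in mP posP PN PN0 *; set N := Hahn_neg G in mN negN PN PN0 *.
have int0 (mu : {finite_measure set (R * R)%type -> \bar R}) A : measurable A ->
    mu A = 0%E -> \int[mu]_(t in D) (\1_A t * W t) = 0.
  move=> mA A0.
  have mf : measurable_fun D (fun t => \1_A t * W t).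
    by apply: measurable_funM => //; exact: measurable_indic.
  have bf : bounded_on D (fun t => \1_A t * W t).
    by apply: bounded_onM => //; exact: bounded_on_indic.
  have intf := bounded_on_integrable mu mD mf bf.
  apply/eqP; rewrite -normr_le0; apply: le_trans (le_normr_Rintegral mD intf) _.
  have /(ae_eq_integral_abs mu mD)[_ h] : measurable_fun D (EFin \o (fun t => \1_A t * W t)).
    exact/measurable_EFinP.
  rewrite /Rintegral -/(comp _ _) h//.
  exists A; split => // t /= nt; apply: contrapT => At; apply: nt => Dt.
  by rewrite indicE memNset// mul0r.
have pE A : measurable A -> p A = G (A `&` P).
  move=> mA; have -> : p A = jordan_pos (Hahn_posneg G) A by [].
  by rewrite jordan_posE cjordan_posE /crestr0 mem_set.
have nE A : measurable A -> n A = (- G (A `&` N))%E.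
  move=> mA; have -> : n A = jordan_neg (Hahn_posneg G) A by [].
  by rewrite jordan_negE cjordan_negE /crestr0 mem_set.
have mEP : measurable (E `&` P) by exact: measurableI.
have mEN : measurable (E `&` N) by exact: measurableI.
have p0 : p (D `&` (E `&` P)) = 0%E.
  apply: null_of_weight => //; rewrite (same_ind mEP); apply: int0 => //.
  by rewrite nE// -setIA PN0 setI0 charge0 oppe0.
have n0 : n (D `&` (E `&` N)) = 0%E.
  apply: null_of_weight => //; rewrite -(same_ind mEN); apply: int0 => //.
  by rewrite pE// -setIA (setIC N) PN0 setI0 charge0.
rewrite -GD// -[E `&` D]setIT -PN setIUr chargeU.
- have -> : G (E `&` D `&` P) = 0%E.
    rewrite -p0 pE; last exact: measurableI.
    by congr (G _); apply/seteqP; split => t /=; tauto.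
  have -> : G (E `&` D `&` N) = 0%E.
    apply: oppe_inj; rewrite oppe0 -n0 nE; last exact: measurableI.
    by congr (- G _)%E; apply/seteqP; split => t /=; tauto.
  by rewrite adde0.
- by apply: measurableI => //; exact: measurableI.
- by apply: measurableI => //; exact: measurableI.
- by rewrite setIACA PN0 setI0.
Qed.

End MixtureInjective.

(** * Parameter derivatives of the kernel *)

(** The difference quotients along v are those of the restriction to the line
    through t in the direction v. *)
Lemma is_derive_line {R : realType} (w : R * R -> R) (t v : R * R) (l : R) :
  is_derive (0 : R) 1 (fun s : R => w (s *: v + t)) l -> is_derive t v w l.
Proof.
have E : (fun h : R => h^-1 *: ((w \o shift t) (h *: v) - w t)) =
    (fun h : R => h^-1 *: (((fun s : R => w (s *: v + t)) \o shift 0) (h *: (1 : R)) -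
      w ((0 : R) *: v + t))).
  by apply/funext => h /=; rewrite addr0 scale0r add0r [h *: (1 : R)]mulr1.
move=> [df dl]; apply: DeriveDef.
  by rewrite /derivable E.
by rewrite -dl /derive E.
Qed.

Lemma is_derive_expline {R : realType} (k c s : R) :
  is_derive s 1 (fun s : R => k * expR (s * c)) (k * c * expR (s * c)).
Proof.
have h1 : is_derive s 1 (fun s : R => s * c) c.
  by apply: (@is_derive_eq _ _ _ (id * cst c)); rewrite /cst/= scaler0 add0r; exact: mulr1.
have h2 := is_derive1_comp (f := expR) (g := fun s => s * c) (is_derive_expR (s * c)) h1.
have h3 := is_deriveZ k h2.
by apply: is_derive_eq h3 _; rewrite -mulrA (mulrC c).
Qed.

Section KernelDerivatives.
Context {R : realType}.
Variable b : R.
Implicit Types (t : R * R) (x : R) (e : bool).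

(** The coordinate directions and the two sufficient statistics, indexed by
    the same boolean, so that both partial derivatives are treated at once. *)
Definition dir e : R * R := if e then (1, 0) else (0, 1).
Definition stat e x : R := if e then x else expR (x ^+ 2).

(** An open set containing [Theta a b] on which the normaliser is finite. *)
Definition natural_domain : set (R * R) := [set t | t.2 < 2 * b].

Lemma open_natural_domain : open natural_domain.
Proof.
rewrite (_ : natural_domain = snd @^-1` [set y | y < 2 * b]); last by [].
by apply: open_comp; [move=> t _; exact: cvg_snd|exact: open_lt].
Qed.

Lemma tilt_line x e (s : R) t : tilt b x (s *: dir e + t) = tilt b x t * expR (s * stat e x).
Proof.
rewrite !tilt_exp -expRD; congr expR; case: e => /=.
  by rewrite [s *: 1]mulr1 [s *: 0]mulr0; ring.
by rewrite [s *: 1]mulr1 [s *: 0]mulr0; ring.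
Qed.

Lemma is_derive_tilt x e t : is_derive t (dir e) (tilt b x) (stat e x * tilt b x t).
Proof.
apply: is_derive_line; under eq_fun do rewrite tilt_line.
have := is_derive_expline (tilt b x t) (stat e x) 0; rewrite mul0r expR0 mulr1 mulrC.
exact.
Qed.

Definition kernel_moment k m t : R :=
  \int[lebesgue_measure]_x (x ^+ k * expR (x ^+ 2) ^+ m * tilt b x t).

(** Differentiating a moment in one direction multiplies the integrand by the
    statistic of that direction. *)
Definition bump_moment e k m : R * R -> R :=
  if e then kernel_moment k.+1 m else kernel_moment k m.+1.

Lemma bump_momentE e k m t : bump_moment e k m t =
  \int[lebesgue_measure]_x (x ^+ k * expR (x ^+ 2) ^+ m * tilt b x t * stat e x).
Proof.
rewrite /bump_moment /kernel_moment; case: e; apply: eq_Rintegral => x _ /=.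
  by rewrite [x ^+ k.+1]exprSr; ring.
by rewrite [_ ^+ m.+1]exprSr; ring.
Qed.

(** Differentiation under the integral sign along the line s |-> s v + t. *)
Lemma is_derive_kernel_moment e k m t : natural_domain t ->
  is_derive t (dir e) (kernel_moment k m) (bump_moment e k m t).
Proof.
rewrite /natural_domain /= => tb.
apply: is_derive_line.
pose f (s x : R) := x ^+ k * expR (x ^+ 2) ^+ m * tilt b x t * expR (s * stat e x).
have fE s : (fun x => f s x) =
    (fun x => x ^+ k * expR (x ^+ 2) ^+ m * tilt b x (s *: dir e + t)).
  by apply/funext => x; rewrite tilt_line mulrA.
have df (s x : R) : is_derive s 1 (f ^~ x) (f s x * stat e x).
  apply: (is_derive_eq (is_derive_expline (x ^+ k * expR (x ^+ 2) ^+ m * tilt b x t) _ s)).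
  by rewrite /f mulrAC.
have d1f s x : partial1of2 f s x = f s x * stat e x.
  by rewrite partial1of2E; have [_ ->] := df s x.
(* For s of size less than dlt the second parameter stays at distance at least
   (2 b - t.2) / 2 from the boundary 2 b, and the first moves by less than 1, so
   that a single Gaussian dominates all the integrands. *)
pose dlt := Num.min 1 ((2 * b - t.2) / 2).
have dlt0 : 0 < dlt by rewrite lt_min ltr01 divr_gt0// subr_gt0.
have dlt1 : dlt <= 1 by rewrite ge_min lexx.
have dlt2 : dlt <= (2 * b - t.2) / 2 by rewrite ge_min lexx orbT.
have near1 (s : R) : s \in `]- dlt, dlt[ -> `|(s *: dir e + t).1| <= `|t.1| + 1.
  rewrite in_itv/= => /andP[s1 s2]; apply: le_trans (ler_normD _ _) _.
  rewrite addrC lerD2l; case: e {f fE df d1f} => /=.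
    by rewrite [s *: 1]mulr1 ler_norml; apply/andP; split; lra.
  by rewrite [s *: 0]mulr0 normr0.
have near2 (s : R) : s \in `]- dlt, dlt[ -> (2 * b - t.2) / 2 <= 2 * b - (s *: dir e + t).2.
  rewrite in_itv/= => /andP[s1 s2]; case: e {f fE df d1f near1} => /=.
    by rewrite [s *: 0]mulr0 add0r; lra.
  by rewrite [s *: 1]mulr1; lra.
have c0 : 0 < (2 * b - t.2) / 2 by rewrite divr_gt0// subr_gt0.
pose k' := if e then k.+1 else k; pose m' := if e then m else m.+1.
have [C C0 dom] := @tilt_moment_le R b k' m' (`|t.1| + 1) _ c0.
have fs s x : f s x * stat e x = x ^+ k' * expR (x ^+ 2) ^+ m' * tilt b x (s *: dir e + t).
  rewrite tilt_line /f /k' /m'; case: e {fE df d1f near1 near2 k' m' dom f} => /=.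
    by rewrite [x ^+ k.+1]exprSr; ring.
  by rewrite [_ ^+ m.+1]exprSr; ring.
have I0 : `]- dlt, dlt[%classic (0 : R) by rewrite /= in_itv/= oppr_lt0 dlt0.
have intf s : `]- dlt, dlt[%classic s ->
    (@lebesgue_measure R).-integrable setT (EFin \o f s).
  move=> /near2 s2; rewrite [f s]fE; apply: tilt_moment_integrable; lra.
have derf s x : `]- dlt, dlt[%classic s -> setT x -> derivable (f ^~ x) s 1.
  by move=> _ _; have [] := df s x.
have intG : (@lebesgue_measure R).-integrable setT (EFin \o (fun x => C * gauss_fun x)).
  rewrite /comp; under eq_fun do rewrite EFinM.
  by apply: integrableZl => //; exact: integrableT_gauss.
have G0 (x : R) : 0 <= C * gauss_fun x by rewrite mulr_ge0// gauss_fun_ge0.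
have G_ub s x : `]- dlt, dlt[%classic s -> setT x -> `|partial1of2 f s x| <= C * gauss_fun x.
  move=> sI _; rewrite d1f fs normrM (gtr0_norm (tilt_gt0 _ _ _)).
  by apply: dom; [exact: near1|exact: near2].
have cvgF := @cvg_differentiation_under_integral R _ _ lebesgue_measure f setT measurableT 0
  (- dlt) dlt I0 intf derf (fun x => C * gauss_fun x) G0 intG G_ub.
have FE : (fun s : R => kernel_moment k m (s *: dir e + t)) =
    (fun s => \int[lebesgue_measure]_x f s x).
  by apply/funext => s; rewrite /kernel_moment -fE.
have limE : \int[lebesgue_measure]_x partial1of2 f 0 x = bump_moment e k m t.
  rewrite bump_momentE; apply: eq_Rintegral => x _.
  by rewrite d1f /f mul0r expR0 mulr1.
rewrite FE -limE; pose F s := \int[lebesgue_measure]_x f s x.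
have quotE : (fun h : R => h^-1 *: ((F \o shift 0) (h *: (1 : R)) - F 0)) =
    (fun h => h^-1 *: (F (h + 0) - F 0)).
  by apply/funext => h /=; rewrite [h *: (1 : R)]mulr1.
apply: DeriveDef.
  by rewrite /derivable quotE; exact: cvgP cvgF.
rewrite /derive quotE; exact: (cvg_lim (@Rhausdorff R) cvgF).
Qed.

Lemma partition_fun_gt0 t : natural_domain t -> 0 < partition_fun b t.
Proof.
rewrite /natural_domain /= => tb.
have c0 : 0 < 2 * b - t.2 by rewrite subr_gt0.
have [z z0 zZ] := @partition_fun_ge R b `|t.1| _ (2 * b - t.2) c0.
by apply: lt_le_trans z0 (zZ t _ _); rewrite ?lexx.
Qed.

Lemma is_derive_weight e t : natural_domain t ->
  is_derive t (dir e) (weight b) (- (bump_moment e 0 0 t * (weight b t * weight b t))).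
Proof.
move=> Wt; have Z0 := partition_fun_gt0 Wt.
have ZE : kernel_moment 0 0 = partition_fun b.
  by apply/funext => s; apply: eq_Rintegral => x _; rewrite !expr0 !mul1r.
have [dZ DZ] := is_derive_kernel_moment e 0 0 Wt; rewrite ZE in dZ DZ.
have dV : is_derive t (dir e) (fun s => (partition_fun b s)^-1)
    (- (bump_moment e 0 0 t * (weight b t * weight b t))).
  apply: DeriveDef; first by apply: derivableV => //; rewrite gt_eqF.
  rewrite deriveV ?gt_eqF// DZ weight_partition//.
  by rewrite -expr2 -exprVn scaleNr mulrC.
apply: near_eq_is_derive dV.
have := open_natural_domain; rewrite openE => /(_ t Wt); rewrite /interior/=.
by apply: filterS => s Ws; rewrite weight_partition// partition_fun_gt0.
Qed.

(** Formal expressions for the functions of the parameter that occur as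
    coefficients when the kernel is differentiated. They form the differential
    ring generated by the weight and the moments. *)
Inductive coef_expr :=
  | CZero | CWeight | CMoment of nat & nat
  | COpp of coef_expr | CAdd of coef_expr & coef_expr | CMul of coef_expr & coef_expr.

Fixpoint ceval u t : R :=
  match u with
  | CZero => 0
  | CWeight => weight b t
  | CMoment k m => kernel_moment k m t
  | COpp u => - ceval u t
  | CAdd u v => ceval u t + ceval v t
  | CMul u v => ceval u t * ceval v t
  end.

Fixpoint cderive e u :=
  match u with
  | CZero => CZero
  | CWeight => COpp (CMul (if e then CMoment 1 0 else CMoment 0 1) (CMul CWeight CWeight))
  | CMoment k m => if e then CMoment k.+1 m else CMoment k m.+1
  | COpp u => COpp (cderive e u)
  | CAdd u v => CAdd (cderive e u) (cderive e v)
  | CMul u v => CAdd (CMul (cderive e u) v) (CMul u (cderive e v))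
  end.

Lemma is_derive_ceval e u t : natural_domain t ->
  is_derive t (dir e) (ceval u) (ceval (cderive e u) t).
Proof.
move=> Wt; elim: u => [||k m|u IH|u IHu v IHv|u IHu v IHv] /=.
- exact: is_derive_cst.
- apply: is_derive_eq; first exact: is_derive_weight.
  by rewrite /bump_moment; case: e.
- apply: is_derive_eq; first exact: is_derive_kernel_moment.
  by rewrite /bump_moment; case: e.
- exact: is_deriveN.
- exact: is_deriveD.
- have h := is_deriveM IHu IHv.
  apply: (is_derive_eq h).
  by rewrite addrC; congr (_ + _); rewrite /GRing.scale/= mulrC.
Qed.

(** Syntactically zero expressions, a class that is stable under [cderive]. *)
Fixpoint czero u := match u with
  | CZero => true
  | CAdd u v => czero u && czero v
  | _ => false
  end.

Lemma czero_ceval u t : czero u -> ceval u t = 0.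
Proof. by elim: u => //= u IHu v IHv /andP[/IHu -> /IHv ->]; rewrite addr0. Qed.

Lemma czero_cderive e u : czero u -> czero (cderive e u).
Proof. by elim: u => //= u IHu v IHv /andP[/IHu -> /IHv ->]. Qed.

(** One differentiation of [tilt x t * sum_(k, m) q k m x^k (exp x^2)^m]: the
    exponential contributes a shift, the coefficients their derivatives. *)
Definition step e (q : nat -> nat -> coef_expr) (k m : nat) : coef_expr :=
  CAdd (if e then (if k is k'.+1 then q k' m else CZero)
             else (if m is m'.+1 then q k m' else CZero))
       (cderive e (q k m)).

Definition coef0 (k m : nat) := if (k == 0)%N && (m == 0)%N then CWeight else CZero.

Definition coef_of (al : multi_index) := iter al.1 (step true) (iter al.2 (step false) coef0).

Lemma czero_coef_of al k m : (al.1 < k)%N || (al.2 < m)%N -> czero (coef_of al k m).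
Proof.
case: al => i j /=; rewrite /coef_of/=; elim: i k m => [|i IH] k m /=.
  elim: j k m => [|j IHj] k m /=.
    by rewrite /coef0; case: k m => [|k] [|m].
  move=> kjm; rewrite /step/= czero_cderive ?andbT; last first.
    by apply: IHj; case/orP: kjm => [->//|/ltnW ->]; rewrite orbT.
  case: m kjm => [|m]//= kjm; apply: IHj.
  by move: kjm; rewrite ltnS.
move=> kjm; rewrite czero_cderive ?andbT; last first.
  by apply: IH; case/orP: kjm => [/ltnW ->//|->]; rewrite orbT.
by case: k kjm => [|k]//= kjm; apply: IH; move: kjm; rewrite ltnS.
Qed.

Lemma coef_of_top al t : ceval (coef_of al al.1 al.2) t = weight b t.
Proof.
case: al => i j /=; rewrite /coef_of/=; elim: i => [|i IH] /=.
  elim: j => [|j IHj]//=.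
  rewrite IHj czero_ceval ?addr0//; apply: czero_cderive.
  by apply: (@czero_coef_of (0%N, j)); rewrite /= ltnSn ?orbT.
rewrite IH czero_ceval ?addr0//; apply: czero_cderive.
by apply: (@czero_coef_of (i, j)); rewrite /= ltnSn.
Qed.

Definition stat_poly n (q : nat -> nat -> R) x : R :=
  \sum_(m < n) \sum_(k < n) q k m * (x ^+ k * expR (x ^+ 2) ^+ m).

Lemma is_derive_tilt_poly n e q x t : natural_domain t ->
  is_derive t (dir e) (fun t => tilt b x t * stat_poly n (fun k m => ceval (q k m) t) x)
   (tilt b x t * (stat e x * stat_poly n (fun k m => ceval (q k m) t) x +
                  stat_poly n (fun k m => ceval (cderive e (q k m)) t) x)).
Proof.
move=> Wt.
have dS : is_derive t (dir e) (fun t => stat_poly n (fun k m => ceval (q k m) t) x)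
    (stat_poly n (fun k m => ceval (cderive e (q k m)) t) x).
  rewrite (_ : (fun t => _) = \sum_(m < n) \sum_(k < n)
      (fun t => (x ^+ k * expR (x ^+ 2) ^+ m) * ceval (q k m) t)); last first.
    apply/funext => s; rewrite /stat_poly fct_sumE; apply: eq_bigr => m _.
    by rewrite fct_sumE; apply: eq_bigr => k _; rewrite mulrC.
  apply: is_derive_sum => m; apply: is_derive_sum => k.
  apply: is_derive_eq; first exact: (is_deriveZ _ (is_derive_ceval e (q k m) Wt)).
  exact: mulrC.
apply: is_derive_eq; first exact: (is_deriveM (is_derive_tilt x e t) dS).
by rewrite /GRing.scale/=; ring.
Qed.

(** In degree at most n, the shift of [step] loses nothing, since the
    coefficients of degree n in the direction of the shift are zero. *)
Lemma stat_poly_step n e q x t :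
  (forall i, czero (if e then q n i else q i n)) ->
  stat e x * stat_poly n.+1 (fun k m => ceval (q k m) t) x +
    stat_poly n.+1 (fun k m => ceval (cderive e (q k m)) t) x =
  stat_poly n.+1 (fun k m => ceval (step e q k m) t) x.
Proof.
move=> qn.
have -> : stat_poly n.+1 (fun k m => ceval (step e q k m) t) x =
   stat_poly n.+1 (fun k m => ceval (if e then (if k is k'.+1 then q k' m else CZero)
             else (if m is m'.+1 then q k m' else CZero)) t) x +
   stat_poly n.+1 (fun k m => ceval (cderive e (q k m)) t) x.
  rewrite /stat_poly -big_split; apply: eq_bigr => m _.
  by rewrite -big_split; apply: eq_bigr => k _; rewrite /= mulrDl.
congr (_ + _); rewrite /stat_poly; case: e qn => qn.
  rewrite mulr_sumr; apply: eq_bigr => m _.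
  rewrite big_ord_recr/= (czero_ceval _ (qn m)) mul0r addr0 big_ord_recl/= mul0r add0r.
  by rewrite mulr_sumr; apply: eq_bigr => k _; rewrite /bump/= add1n add0n [x ^+ k.+1]exprS; ring.
rewrite big_ord_recr/= [X in _ * (_ + X)]big1 ?addr0; last first.
  by move=> k _; rewrite (czero_ceval _ (qn k)) mul0r.
rewrite big_ord_recl/= [X in _ = X + _]big1 ?add0r; last first.
  by move=> k _; rewrite mul0r.
rewrite mulr_sumr; apply: eq_bigr => m _; rewrite mulr_sumr; apply: eq_bigr => k _.
by rewrite /bump/= add1n ?add0n [_ ^+ m.+1]exprS; ring.
Qed.

Lemma derive_tilt_poly n e q x (u : R * R -> R) :
  (forall i, czero (if e then q n i else q i n)) ->
  (forall t, natural_domain t ->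
    u t = tilt b x t * stat_poly n.+1 (fun k m => ceval (q k m) t) x) ->
  forall t, natural_domain t -> 'D_(dir e) u t =
    tilt b x t * stat_poly n.+1 (fun k m => ceval (step e q k m) t) x.
Proof.
move=> qn uE t Wt.
have [_ D] := is_derive_tilt_poly n.+1 e q x Wt.
rewrite -stat_poly_step// -D; apply: near_eq_derive.
have := open_natural_domain; rewrite openE => /(_ t Wt); rewrite /interior/=.
by apply: filterS => s; exact: uE.
Qed.

(** By induction on the multi-index: each differentiation either multiplies by
    a statistic or differentiates the coefficients, all of them polynomials in
    the weight and the moments. *)
Lemma partial_kernel n (al : multi_index) x t : (al.1 <= n)%N -> (al.2 <= n)%N ->
  natural_domain t -> partial al (expfam_kernel b x) t =
  tilt b x t * stat_poly n.+1 (fun k m => ceval (coef_of al k m) t) x.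
Proof.
case: al => i j /= + jn; elim: i t => [|i IH] t i_n Wt.
  rewrite /partial/=; elim: j jn t Wt => [|j IHj] jn t Wt /=.
    rewrite expfam_kernelE; congr (_ * _).
    rewrite /stat_poly big_ord_recl [X in _ + X]big1 ?addr0; last first.
      by move=> m _; rewrite big1// => k _; rewrite /coef_of/= /coef0 andbF mul0r.
    rewrite big_ord_recl [X in _ + X]big1 ?addr0; last first.
      by move=> k _; rewrite /coef_of/= /coef0 mul0r.
    by rewrite !expr0 !mulr1.
  apply: (@derive_tilt_poly n false (coef_of (0%N, j))) => //.
    by move=> k; apply: czero_coef_of; rewrite /= jn orbT.
  by move=> s Ws; apply: IHj => //; exact: ltnW.
apply: (@derive_tilt_poly n true (coef_of (i, j))) => //.
  by move=> m; apply: czero_coef_of; rewrite /= i_n.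
by move=> s Ws; apply: IH => //; exact: ltnW.
Qed.

Lemma stat_poly_curve_series n q x :
  stat_poly n q x = curve_series (fun k m =>
    if (k < n)%N && (m < n)%N then k`!%:R * m`!%:R * q k m else 0) x.
Proof.
have f0 k : k`!%:R != 0 :> R by rewrite pnatr_eq0 -lt0n fact_gt0.
rewrite /curve_series (@tsum_fin _ n); last first.
  move=> m nm; rewrite tsum0 ?mulr0// => k.
  by rewrite [(m < n)%N]ltnNge nm andbF mulr0.
apply: eq_bigr => m _; rewrite (@tsum_fin _ n); last first.
  by move=> k nk; rewrite [(k < n)%N]ltnNge nk mulr0.
rewrite mulr_sumr; apply: eq_bigr => k _; rewrite !ltn_ord/=.
by field; rewrite !f0.
Qed.

Lemma stat_poly_eq0 n q :
  (forall e : R, 0 < e -> exists2 x, 0 < x < e & stat_poly n q x = 0) ->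
  forall k m, (k < n)%N -> (m < n)%N -> q k m = 0.
Proof.
move=> small k m kn mn.
have f0 i : i`!%:R != 0 :> R by rewrite pnatr_eq0 -lt0n fact_gt0.
pose c i j : R := if (i < n)%N && (j < n)%N then i`!%:R * j`!%:R * q i j else 0.
suff : c k m = 0.
  by rewrite /c kn mn => /eqP; rewrite !mulf_eq0 !(negPf (f0 _)) => /eqP.
apply: (@curve_series_coef_eq0 _ (\sum_(i < n) \sum_(j < n) `|c i j|) 1 1) => //.
  move=> i j; rewrite !expr1n !mulr1.
  have c0 i' : 0 <= \sum_(j < n) `|c i' j| by rewrite sumr_ge0.
  have [/andP[i_n jn]|ij] := boolP ((i < n)%N && (j < n)%N).
    rewrite (bigD1 (Ordinal i_n))//= (bigD1 (Ordinal jn))//= -addrA lerDl.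
    by rewrite addr_ge0 ?sumr_ge0.
  have -> : c i j = 0 by rewrite /c (negPf ij).
  by rewrite normr0 sumr_ge0.
by move=> e /small[x xe x0]; exists x => //; rewrite -stat_poly_curve_series.
Qed.

(** The statistics x^k exp(m x^2) are linearly independent, and the triangular
    shape of the derivatives lets the coefficients be killed from the top
    order down. *)
Lemma diff_op_kernel_eq0 r (c : multi_index -> R * R -> R) t : natural_domain t ->
  {ae lebesgue_measure, forall x : R, diff_op r c (expfam_kernel b x) t = 0} ->
  forall al, (mi_size al <= r)%N -> c al t = 0.
Proof.
move=> Wt c0.
pose E k m := \sum_(al : 'I_r.+1 * 'I_r.+1 | (al.1 + al.2 <= r)%N)
  c (al.1 : nat, al.2 : nat) t * ceval (coef_of (al.1 : nat, al.2 : nat) k m) t.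
have diffE x : diff_op r c (expfam_kernel b x) t = tilt b x t * stat_poly r.+1 E x.
  rewrite /diff_op /stat_poly.
  under eq_bigr => al _.
    rewrite (@partial_kernel r) ?leq_ord// mulrCA.
    over.
  rewrite -mulr_sumr; congr (_ * _); rewrite /stat_poly.
  under eq_bigr do rewrite mulr_sumr.
  rewrite exchange_big; apply: eq_bigr => m _ /=.
  under eq_bigr do rewrite mulr_sumr.
  rewrite exchange_big; apply: eq_bigr => k _ /=.
  rewrite /E mulr_suml.
  apply: eq_bigr => al _.
  exact: mulrA.
have E0 : forall k m, (k < r.+1)%N -> (m < r.+1)%N -> E k m = 0.
  apply: stat_poly_eq0 => e e0; have [x xe] := ae_near_0 c0 e0.
  rewrite diffE => /eqP; rewrite mulf_eq0 gt_eqF ?tilt_gt0//= => /eqP.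
  by exists x.
move=> al; have [d] := ubnP (r - mi_size al); elim: d al => // d IH [i j].
rewrite /mi_size/= => dij ijr.
have i_r : (i < r.+1)%N by rewrite ltnS (leq_trans _ ijr)// leq_addr.
have jr : (j < r.+1)%N by rewrite ltnS (leq_trans _ ijr)// leq_addl.
have := E0 i j i_r jr; rewrite /E (bigD1 (Ordinal i_r, Ordinal jr))//=.
rewrite coef_of_top [X in _ + X]big1 ?addr0.
  by move=> /eqP; rewrite mulf_eq0 [weight b t == 0]gt_eqF ?weight_gt0// orbF => /eqP.
move=> [[i' i'r] [j' j'r]]/= /andP[ij'r neq].
have [ii|ii] := ltnP i' i.
  by rewrite [ceval _ _]czero_ceval ?mulr0//; apply: czero_coef_of; rewrite /= ii.
have [jj|jj] := ltnP j' j.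
  by rewrite [ceval _ _]czero_ceval ?mulr0//; apply: czero_coef_of; rewrite /= jj orbT.
rewrite IH ?mul0r// /mi_size/=.
have lt_ij : (i + j < i' + j')%N.
  rewrite ltn_neqAle leq_add// andbT; apply: contra neq => /eqP ij.
  have ei : i' = i by apply/eqP; rewrite eqn_leq ii andbT -(leq_add2r j) ij leq_add2l.
  have ej : j' = j by apply/eqP; move/eqP: ij; rewrite ei eqn_add2l eq_sym.
  by apply/eqP; congr (_, _); apply: val_inj.
by rewrite -ltnS (leq_trans _ dij)// ltnS ltn_sub2l// (leq_trans lt_ij).
Qed.

End KernelDerivatives.

(** * The theorem *)

Unset Implicit Arguments.

Theorem proposition6 (R : realType) (a b : R) (a_gt0 : 0 < a) (b_gt0 : 0 < b) :
  (* (a) *)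
  [/\ (forall (r : nat) (c : multi_index -> R * R -> R),
         (forall al, (mi_size al <= r)%N ->
            {within (Theta a b)°, continuous (c al)}) ->
         annihilates r c (@expfam_kernel R b) (Theta a b)° ->
         forall al, (mi_size al <= r)%N ->
           forall t, (Theta a b)° t -> c al t = 0),
      (forall U : set (R * R), open U -> U !=set0 -> U `<=` (Theta a b)° ->
         ~ satisfies_nontrivial_PDE (@expfam_kernel R b) U)
  (* (b) *)
    & (forall G : {charge set (R * R)%type -> \bar R},
         carried_by G (Theta a b) ->
         {ae lebesgue_measure,
            forall x : R, mixture (Theta a b) (@expfam_kernel R b) G x = 0} ->
         forall E : set (R * R), measurable E -> G E = 0%E)].
Proof.
have dom t : (Theta a b)° t -> natural_domain b t.
  move=> /interior_subset[_ /=]; rewrite in_itv/= => /andP[_ tb].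
  by rewrite /natural_domain/=; lra.
split.
- move=> r c _ annih al alr t tU.
  exact: (diff_op_kernel_eq0 (dom t tU) (annih t tU)).
- move=> U _ _ UT [r [c [_ [al [/andP[_ alr] [t tU /eqP ct0]]] annih]]]; apply: ct0.
  exact: (diff_op_kernel_eq0 (dom t (UT t tU)) (annih t tU)).
- move=> G GD mix0; exact: (mixture_injective a_gt0 b_gt0 GD mix0).
Qed.
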